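(* Let $x,y\in\mathfrak{su}(n)$ and let $u(t)=e^{tx}e^{y}=e^{x(t)}\in \mathrm{SU}(n)$ be defined for $t\in[t_1,t_2]$, where $x(t)\in\mathfrak{su}(n)$ and $\|x(t)\|_\infty<\frac{\pi}{2}$ for all $t\in[t_1,t_2]$. Let $\|\cdot\|$ be an $\mathrm{Ad}$-invariant norm on $\mathfrak{su}(n)$. Then the function $t\mapsto\|x(t)\|$ is convex for $t\in[t_1,t_2]$.
   Context: $\mathrm{SU}(n)$ is the group of $n\times n$ unitary matrices with determinant $1$, and $\mathfrak{su}(n)$ is its Lie algebra of traceless skew-Hermitian matrices. $\|\cdot\|_\infty$ is the spectral (operator) norm. A norm on $\mathfrak{su}(n)$ is $\mathrm{Ad}$-invariant if $\|uvu^{-1}\|=\|v\|$ for all $u\in \mathrm{SU}(n)$ and $v\in\mathfrak{su}(n)$. *)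

(* Defs.v *)
From HB Require Import structures.
From mathcomp Require Import all_boot all_order all_algebra.
From mathcomp Require Export complex.
From mathcomp Require Import all_classical all_reals all_analysis.

Set Implicit Arguments.
Unset Strict Implicit.
Unset Printing Implicit Defensive.

Import Order.TTheory GRing.Theory Num.Theory.
Import numFieldNormedType.Exports.
Import ComplexField.

Local Open Scope classical_set_scope.
Local Open Scope ring_scope.
Local Open Scope complex_scope.
Local Open Scope sesquilinear_scope.

(* Stated over a generic K because the topology on R[i] is the one it inherits
   as a numFieldType; the limit is taken in the matrix topology. *)
Definition expmx (K : numFieldType) (n : nat) (A : 'M[K]_n) : 'M[K]_n :=
  limn (series (fun k : nat => k`!%:R^-1 *: A ^+ k)).

Definition SU (R : realType) (n : nat) : set 'M[R[i]]_n :=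
  [set u | u \is unitarymx /\ \det u = 1].

Definition su (R : realType) (n : nat) : set 'M[R[i]]_n :=
  [set v | v ^t* = - v /\ \tr v = 0].

(* [Normc.normc] is the modulus with values in R; `|z| would lie in R[i]. *)
Definition euclidean_norm (R : realType) (n : nat) (v : 'cV[R[i]]_n) : R :=
  Num.sqrt (\sum_i Normc.normc (v i 0) ^+ 2).

Definition spectral_norm (R : realType) (n : nat) (A : 'M[R[i]]_n) : R :=
  sup [set euclidean_norm (A *m v) |
        v in [set v : 'cV[R[i]]_n | euclidean_norm v <= 1]].

(* su(n) is a real vector space, so homogeneity is over R only; the values of N
   outside su(n) are irrelevant. *)
Record is_norm_on_su (R : realType) (n : nat) (N : 'M[R[i]]_n -> R) : Prop := {
  su_norm_ge0 : forall v, su v -> 0 <= N v;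
  su_norm_eq0 : forall v, su v -> N v = 0 -> v = 0;
  su_normZ : forall (a : R) v, su v -> N (a%:C *: v) = `|a| * N v;
  su_normD : forall v w, su v -> su w -> N (v + w) <= N v + N w
}.

Definition Ad_invariant (R : realType) (n : nat) (N : 'M[R[i]]_n -> R) : Prop :=
  forall u v, SU u -> su v -> N (u *m v *m invmx u) = N v.

(* Main.v *)
Require Import Defs.
From HB Require Import structures.
From mathcomp Require Import all_boot all_order all_algebra.
From mathcomp Require Import all_fingroup.
From mathcomp Require Import all_classical all_reals all_analysis.
From mathcomp Require Import ring lra.
Set Implicit Arguments.
Unset Strict Implicit.
Unset Printing Implicit Defensive.
Import Order.TTheory GRing.Theory Num.Theory.
Import numFieldNormedType.Exports.
Local Open Scope classical_set_scope.
Local Open Scope ring_scope.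
Local Open Scope complex_scope.
Local Open Scope sesquilinear_scope.

(* It suffices to bound the second differences of [t |-> N (xt t)] from below by
   [- K h ^ 3] around every [c], with [K] depending on [c].

   Work in an eigenbasis of [xt c = i diag th], and conjugate by [exp (- h x / 2)]:
   [xt (c + h)] becomes some [A h] with [exp (A h) = w V w], where
   [V = exp (i diag th)] and [w = exp (i h X / 2)].  Since all eigenvalues lie in
   an interval of length less than pi, the logarithm is Lipschitz (compare
   [A h] and [xt c] entrywise in a pair of eigenbases), and the diagonal of
   [- i A h] has the expansion
     [th_k + h X_kk + h ^ 2 a_k + O(h ^ 3)],
     [a_k = sum_l |X_kl| ^ 2 mu (th_k - th_l) (th_k - th_l)],
   with [mu] even, and nonnegative on [-pi, pi].  Adding the expansions at [h]
   and [- h] cancels the linear term.  Pinching to the diagonal does not increase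
   an Ad-invariant norm, while adding [h ^ 2 a] to [th], which moves the
   eigenvalues apart, does not decrease it. *)

(** The conjugation by [exp (- h x / 2)] decides a sign. Without it, the diagonal of the logarithm
    would carry [(sin b - b) / (2 (1 - cos b))], where [b = th_k - th_l], in place of [mu b * b].
    This is negative for [b > 0]: the second-order term would pull the eigenvalues together, and
    pinching would lose too much. The obstacle is degeneracy: where eigenvalues of [xt c] coincide,
    the usual perturbation formulas break down. The eigenbases of [A h] are therefore chosen for
    each [h] separately, with no continuity in [h], and the estimates concern products such as
    [(d_j - th_l) U_lj], which are small whatever the choice. The logarithm is never expanded as a
    series. In the splitting [a = sin a + (a - sin a)], the sine part is read off from the
    exponential, and [a - sin a], a square times the small factor [chi a], requires only first-order
    knowledge of the entries. *)

Local Notation cmod := (@Normc.normc _).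
Local Notation Re := complex.Re.
Local Notation Im := complex.Im.

(** * Real analysis *)

Section RealAnalysis.
Variable R : realType.
Implicit Types a b x : R.

(** The Taylor bounds below iterate this: the derivative of each difference is the difference of the
    preceding bound. *)
Lemma le_of_derive_ge0 (f df : R -> R) b : 0 <= b ->
  (forall x, is_derive x 1 f (df x)) ->
  (forall x, 0 <= x <= b -> 0 <= df x) -> f 0 <= f b.
Proof.
move=> b0 fdf df0.
have cf : {within `[0, b], continuous f}.
  apply: continuous_subspaceT => x.
  by apply/differentiable_continuous/derivable1_diffP/ex_derive.
have [c cb e] := MVT_segment b0 (fun x _ => fdf x) cf.
rewrite -subr_ge0 e mulr_ge0 ?subr_ge0 //; apply: df0.
by rewrite in_itv in cb.
Qed.

Lemma sin_le_id x : 0 <= x -> sin x <= x.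
Proof.
move=> x0; rewrite -subr_ge0.
pose f y : R := y - sin y.
have -> : 0 = f 0 by rewrite /f sin0 subr0.
exact: (@le_of_derive_ge0 f (fun y => 1 - cos y)).
Qed.

Lemma cos_ge_quadratic x : 0 <= x -> 1 - x ^+ 2 / 2 <= cos x.
Proof.
move=> x0; rewrite -subr_ge0.
pose f y : R := cos y - (1 - y ^+ 2 / 2).
have -> : 0 = f 0 by rewrite /f cos0; ring.
apply: (@le_of_derive_ge0 f (fun y => y - sin y)) => // y.
  by rewrite /f; apply: is_derive_eq; rewrite /GRing.scale /=; field.
by move=> /andP[y0 _]; rewrite subr_ge0 sin_le_id.
Qed.

Lemma sin_ge_cubic x : 0 <= x -> x - x ^+ 3 / 6 <= sin x.
Proof.
move=> x0; rewrite -subr_ge0.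
pose f y : R := sin y - (y - y ^+ 3 / 6).
have -> : 0 = f 0 by rewrite /f sin0; ring.
apply: (@le_of_derive_ge0 f (fun y => cos y - (1 - y ^+ 2 / 2))) => // y.
  by rewrite /f; apply: is_derive_eq; rewrite /GRing.scale /=; field.
by move=> /andP[y0 _]; rewrite subr_ge0 cos_ge_quadratic.
Qed.

Lemma cos_le_quartic x : 0 <= x -> cos x <= 1 - x ^+ 2 / 2 + x ^+ 4 / 24.
Proof.
move=> x0; rewrite -subr_ge0.
pose f y : R := 1 - y ^+ 2 / 2 + y ^+ 4 / 24 - cos y.
have -> : 0 = f 0 by rewrite /f cos0; ring.
apply: (@le_of_derive_ge0 f (fun y => sin y - (y - y ^+ 3 / 6))) => // y.
  by rewrite /f; apply: is_derive_eq; rewrite /GRing.scale /=; field.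
by move=> /andP[y0 _]; rewrite subr_ge0 sin_ge_cubic.
Qed.

Lemma mul_cos_le_sin x : 0 <= x <= pi -> x * cos x <= sin x.
Proof.
move=> /andP[x0 xpi]; rewrite -subr_ge0.
pose f y : R := sin y - y * cos y.
have -> : 0 = f 0 by rewrite /f sin0; ring.
apply: (@le_of_derive_ge0 f (fun y => y * sin y)) => // y.
  by rewrite /f; apply: is_derive_eq; rewrite /GRing.scale /=; field.
move=> /andP[y0 yx]; rewrite mulr_ge0 // sin_ge0_pi //.
by rewrite y0 (le_trans yx).
Qed.

Lemma normr_sin_sub_id_le x : `|x - sin x| <= `|x| ^+ 3.
Proof.
wlog x0 : x / 0 <= x.
  move=> H; have [/H//|/ltW x0] := leP 0 x.
  by have := H (- x); rewrite sinN -opprD !normrN oppr_ge0; apply.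
have h1 := sin_le_id x0; have h2 := sin_ge_cubic x0.
have h3 : 0 <= x ^+ 3 by exact: exprn_ge0.
by rewrite (ger0_norm x0) ler_norml; lra.
Qed.

Lemma normr_cos_sub_quadratic_le x : `|cos x - (1 - x ^+ 2 / 2)| <= `|x| ^+ 3.
Proof.
rewrite -(cos_norm x) -(real_normK (num_real x)).
move: (normr_ge0 x); move: `|x| => y y0.
have h1 := cos_ge_quadratic y0; have h2 := cos_le_quartic y0.
have h3 : 0 <= y ^+ 3 by exact: exprn_ge0.
have c1 := cos_le1 y.
rewrite ger0_norm; last lra.
(* The quartic remainder is below the cubic one only up to 1. Beyond, [cos y <= 1] leaves
   [y ^+ 2 / 2]. *)
have [y1|/ltW y1] := leP y 1.
  have h4 : y ^+ 4 <= y ^+ 3 by rewrite exprS ler_piMl.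
  lra.
have h4 : y ^+ 2 <= y ^+ 3 by rewrite [y ^+ 3]exprS ler_peMl // sqr_ge0.
have h5 := sqr_ge0 y; lra.
Qed.

Lemma two_sub_two_cos x : 2 - 2 * cos x = (2 * sin (x / 2)) ^+ 2.
Proof.
have -> : cos x = cos (x / 2 *+ 2) by congr cos; field.
by rewrite cos_mulr2n exprMn sin2cos2; ring.
Qed.

(** For [t = y / 2 <= pi / 2 < 2] the cubic bound gives [sin t >= t (1 - 4 / 6) = t / 3]; the
    constant is the square of this 3. *)
Lemma sqr_le_chord x : `|x| <= pi -> x ^+ 2 <= 9 * (2 - 2 * cos x).
Proof.
rewrite -(cos_norm x) -(real_normK (num_real x)).
move: (normr_ge0 x); move: `|x| => y y0 ypi.
rewrite two_sub_two_cos.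
have t0 : 0 <= y / 2 by lra.
have t2 : y / 2 <= 2 by apply: ltW; apply: le_lt_trans (pihalf_lt2 R); lra.
have h : y / 2 / 3 <= sin (y / 2).
  apply: le_trans (sin_ge_cubic t0).
  move: (y / 2) t0 t2 => t t0 t2.
  have : t * (4 - t ^+ 2) >= 0 by rewrite mulr_ge0 //; nra.
  by rewrite mulrBr mulrC -exprS; lra.
have -> : y ^+ 2 = (3 * (2 * (y / 2 / 3))) ^+ 2 by field.
have -> : 9 = 3 ^+ 2 :> R by ring.
rewrite exprMn ler_pM2l ?exprn_gt0 // ler_sqr ?nnegrE; last 2 first.
- by lra.
- by lra.
by lra.
Qed.

(** In terms of the half angle [t] both sides have the factor [4 cos t >= 0], and what remains is
    [t cos t <= sin t]. This gives the sign of the numerator of [mu]. *)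
Lemma mul_1Dcos_le_2sin x : 0 <= x <= pi -> x * (1 + cos x) <= 2 * sin x.
Proof.
move=> /andP[x0 xpi].
have -> : cos x = cos (x / 2 *+ 2) by congr cos; field.
have -> : sin x = sin (x / 2 *+ 2) by congr sin; field.
rewrite cos_mulr2n sin_mulr2n.
have h1 : x / 2 * cos (x / 2) <= sin (x / 2).
  by apply: mul_cos_le_sin; lra.
have h2 : 0 <= cos (x / 2) by apply: cos_ge0_pihalf; lra.
have -> : x * (1 + (cos (x / 2) ^+ 2 *+ 2 - 1)) =
  (4 * cos (x / 2)) * (x / 2 * cos (x / 2)) by field.
have -> : 2 * ((cos (x / 2) * sin (x / 2)) *+ 2) =
  (4 * cos (x / 2)) * sin (x / 2) by ring.
by rewrite ler_wpM2l ?mulr_ge0.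
Qed.

Lemma within_continuous_of_pointwise_lipschitz (f : R -> R) a b :
  (forall c, a <= c <= b -> exists K, forall x, a <= x <= b -> `|x - c| <= 1 ->
     `|f x - f c| <= K * `|x - c|) ->
  {within `[a, b], continuous f}.
Proof.
move=> H; apply/subspace_continuousP => c /=; rewrite in_itv /= => cab.
have [K HK] := H _ cab.
apply/cvgrPdist_le => e e0; rewrite near_withinE.
have M0 : 0 < e / (`|K| + 1) by rewrite divr_gt0 // ltr_wpDl.
have m0 : 0 < Num.min 1 (e / (`|K| + 1)) by rewrite lt_min ltr01.
near=> x => /=; rewrite in_itv /= => xab.
have : `|c - x| < Num.min 1 (e / (`|K| + 1)).
  by near: x; apply: (@cvgr_dist_lt _ _ _ _ _ id).
rewrite lt_min distrC => /andP[/ltW x1]; rewrite ltr_pdivlMr ?ltr_wpDl // => xe.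
rewrite distrC (le_trans (HK _ xab x1)) // (le_trans _ (ltW xe)) // mulrC.
by rewrite ler_wpM2l // (le_trans (ler_norm K)) // lerDl.
Unshelve. all: by end_near.
Qed.

(** If [f] exceeded its chord at [c], adding a small strictly convex quadratic would keep a positive
    interior maximum. There the second difference is nonpositive, yet the quadratic contributes a
    term of order [h ^+ 2] that the cubic error cannot cancel. *)
Lemma le_chord_of_second_difference (f : R -> R) a b c : a <= c <= b ->
  {within `[a, b], continuous f} ->
  (forall m, a < m < b -> exists K, forall h, 0 < h <= 1 ->
     a <= m - h -> m + h <= b ->
     2 * f m - K * h ^+ 3 <= f (m + h) + f (m - h)) ->
  f c * (b - a) <= f a * (b - c) + f b * (c - a).
Proof.
move=> /andP[ac cb] cf H.
rewrite leNgt; apply/negP => Hc.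
pose D := f c * (b - a) - f a * (b - c) - f b * (c - a).
have D0 : 0 < D by rewrite /D; lra.
have ab : a < b.
  rewrite lt_neqAle (le_trans ac cb) andbT; apply/eqP => e.
  have ca : c = a by apply/eqP; rewrite eq_le ac e cb.
  by move: Hc; rewrite ca -e; lra.
(* With this size the quadratic costs at most [D / 2] at [c], half of the excess. *)
pose eta := D / (2 * (b - a) ^+ 2).
have B2 : 0 < (b - a) ^+ 2 by rewrite exprn_gt0 // subr_gt0.
have eta0 : 0 < eta by rewrite divr_gt0 // mulr_gt0.
pose q (t : R) := eta * ((t - a) * (t - b)) - f a * (b - t) - f b * (t - a).
pose g t := f t * (b - a) + q t.
have cg : {within `[a, b], continuous g}.
  have cq : {within `[a, b], continuous q}.
    apply: continuous_subspaceT => t.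
    by apply/differentiable_continuous/derivable1_diffP/ex_derive.
  move=> t; apply: (@cvgD _ _ _ (nbhs t) _ (fun t => f t * (b - a)) q).
    by apply: (@cvgMl _ _ (nbhs t) _ f); exact: cf.
  exact: cq.
have [m] := EVT_max (ltW ab) cg; rewrite in_itv /= => /andP[am mb] Hm.
have ga : g a = 0 by rewrite /g /q; ring.
have gb : g b = 0 by rewrite /g /q; ring.
have gm : 0 < g m.
  apply: lt_le_trans (Hm c _); last by rewrite in_itv /= ac cb.
  have -> : g c = D - eta * ((c - a) * (b - c)) by rewrite /g /q /D; ring.
  rewrite subr_gt0 (@le_lt_trans _ _ (eta * (b - a) ^+ 2)) //.
    by apply: ler_wpM2l; [exact: ltW|rewrite expr2; apply: ler_pM; lra].
  have -> : eta * (b - a) ^+ 2 = D / 2 by rewrite /eta; field; lra.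
  lra.
have am' : a < m.
  by rewrite lt_neqAle am andbT; apply/eqP => e; rewrite -e ga ltxx in gm.
have mb' : m < b.
  by rewrite lt_neqAle mb andbT; apply/eqP => e; rewrite e gb ltxx in gm.
have [|K HK] := H m; first by rewrite am'.
(* The step [h] is chosen so that [(b - a) K h <= eta] and [m - h], [m + h] stay in the segment. *)
pose L := (b - a) * (`|K| + 1).
have L0 : 0 < L by rewrite mulr_gt0 ?subr_gt0 // ltr_wpDl.
pose h := Num.min (Num.min 1 (eta / L)) (Num.min (m - a) (b - m)).
have h0 : 0 < h.
  by rewrite !lt_min ltr01 !subr_gt0 am' mb' divr_gt0.
have := lexx h; rewrite {2}/h !le_min => /andP[/andP[h1 hL]] /andP[ha hb].
have hah : a <= m - h by lra.
have hbh : m + h <= b by lra.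
have := HK h _ hah hbh; rewrite h0 h1 => /(_ isT) HKh.
have g1 : g (m + h) <= g m by apply: Hm; rewrite in_itv /=; lra.
have g2 : g (m - h) <= g m by apply: Hm; rewrite in_itv /=; lra.
have key : (b - a) * (f (m + h) + f (m - h) - 2 * f m) + 2 * eta * h ^+ 2 <= 0.
  have -> : (b - a) * (f (m + h) + f (m - h) - 2 * f m) + 2 * eta * h ^+ 2 =
    g (m + h) + g (m - h) - 2 * g m by rewrite /g /q; ring.
  by lra.
have k2 : (b - a) * - (K * h ^+ 3) <=
  (b - a) * (f (m + h) + f (m - h) - 2 * f m) by apply: ler_wpM2l; lra.
have k3 : (b - a) * (K * h ^+ 3) <= eta * h ^+ 2.
  have -> : eta * h ^+ 2 = L * (eta / L) * h ^+ 2 by field; lra.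
  apply: (@le_trans _ _ (L * h * h ^+ 2)); last first.
    by apply: ler_wpM2r; [exact: sqr_ge0|apply: ler_wpM2l => //; exact: ltW].
  rewrite -mulrA -exprS /L -mulrA; apply: ler_wpM2l; first lra.
  by apply: ler_wpM2r; [rewrite ltW ?exprn_gt0|have := ler_norm K; lra].
have k4 : 0 < eta * h ^+ 2 by rewrite mulr_gt0 // exprn_gt0.
by move: key k2 k3; rewrite mulrN; lra.
Qed.

Lemma convex_of_second_difference (f : R -> R) t1 t2 :
  (forall c, t1 <= c <= t2 -> exists K, forall x, t1 <= x <= t2 ->
     `|x - c| <= 1 -> `|f x - f c| <= K * `|x - c|) ->
  (forall c, t1 < c < t2 -> exists K, forall h, 0 < h <= 1 ->
     t1 <= c - h -> c + h <= t2 ->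
     2 * f c - K * h ^+ 3 <= f (c + h) + f (c - h)) ->
  convex_function (E := R^o) `[t1, t2] f.
Proof.
move=> Hlip Hdiff s a b; rewrite !inE /= !in_itv /=.
have chord u v w : t1 <= u -> u <= w -> w <= v -> v <= t2 ->
    f w * (v - u) <= f u * (v - w) + f v * (w - u).
  move=> t1u uw wv vt2; apply: le_chord_of_second_difference.
  - by rewrite uw.
  - apply: within_continuous_of_pointwise_lipschitz => c /andP[uc cv].
    have [|K HK] := Hlip c; first by lra.
    by exists K => x /andP[ux xv]; apply: HK; lra.
  - move=> m /andP[um mv]; have [|K HK] := Hdiff m; first by lra.
    by exists K => h h1 uh hv; apply: HK => //; lra.
rewrite convRE => /andP[ta at2] /andP[tb bt2].
have s0 : 0 <= s%:num :> R by [].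
have s1 : s%:num <= 1 :> R by [].
have -> : conv s (a : convex_lmodType R^o) (b : convex_lmodType R^o)
  = s%:num * a + (1 - s%:num) * b :> R by exact: convRE.
move: (s%:num : R) s0 s1 => {s} r r0 r1.
have [ab|ba|->] := ltgtP a b; last by rewrite -!mulrDl; rewrite subrKC !mul1r.
  have := chord a b (r * a + (1 - r) * b) ta.
  have -> : b - (r * a + (1 - r) * b) = r * (b - a) by ring.
  have -> : r * a + (1 - r) * b - a = (1 - r) * (b - a) by ring.
  rewrite !mulrA -mulrDl ler_pM2r ?subr_gt0 //.
  rewrite ![_ * r]mulrC ![_ * (1 - r)]mulrC; apply=> //; nra.
have := chord b a (r * a + (1 - r) * b) tb.
have -> : a - (r * a + (1 - r) * b) = (1 - r) * (a - b) by ring.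
have -> : r * a + (1 - r) * b - b = r * (a - b) by ring.
rewrite !mulrA -mulrDl ler_pM2r ?subr_gt0 //.
rewrite ![_ * r]mulrC ![_ * (1 - r)]mulrC addrC; rewrite [r * f a + _]addrC; apply=> //; nra.
Qed.

End RealAnalysis.

(** * Complex exponentials and unitarily diagonalized matrices *)

Section Complex.
Variable R : realType.
Implicit Types (a b : R) (z w : R[i]).

Lemma cmod_ge0 z : 0 <= cmod z.
Proof. by case: z => a b; rewrite sqrtr_ge0. Qed.

Lemma cmodD z w : cmod (z + w) <= cmod z + cmod w.
Proof. exact: (le_normcD (z : Rcomplex R)). Qed.

Lemma cmodM z w : cmod (z * w) = cmod z * cmod w.
Proof. exact: Normc.normcM. Qed.

Lemma cmodN z : cmod (- z) = cmod z.
Proof. exact: (normcN (z : Rcomplex R)). Qed.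

Lemma cmod_conj z : cmod (Num.conj z) = cmod z.
Proof. by case: z => a b; rewrite /= sqrrN. Qed.

Lemma conjM z w : Num.conj (z * w) = Num.conj z * Num.conj w.
Proof. exact: rmorphM. Qed.

Lemma conj_sum (I : Type) (r : seq I) (P : pred I) (F : I -> R[i]) :
  Num.conj (\sum_(i <- r | P i) F i) = \sum_(i <- r | P i) Num.conj (F i).
Proof. exact: rmorph_sum. Qed.

Lemma real_complexM a b : (a * b)%:C = a%:C * b%:C.
Proof. exact: rmorphM. Qed.

Lemma conj_real a : Num.conj a%:C = a%:C.
Proof. exact: conjc_real. Qed.

Lemma cmod_real a : cmod a%:C = `|a|.
Proof. by rewrite /= expr0n addr0 sqrtr_sqr. Qed.

Lemma cmod_i : cmod ('i : R[i]) = 1.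
Proof. by rewrite /= expr0n add0r expr1n sqrtr1. Qed.

Lemma sqr_cmod z : cmod z ^+ 2 = Re z ^+ 2 + Im z ^+ 2.
Proof. by case: z => a b; rewrite sqr_sqrtr // addr_ge0 ?sqr_ge0. Qed.

Lemma normr_cmod z : `|z| = (cmod z)%:C.
Proof. by case: z. Qed.

Lemma normr_Im_le z : `|Im z| <= cmod z.
Proof.
rewrite -ler_sqr ?nnegrE ?cmod_ge0 // sqr_cmod real_normK ?num_real //.
by rewrite lerDr sqr_ge0.
Qed.

Lemma cmod_le_Re_Im z : cmod z <= `|Re z| + `|Im z|.
Proof.
rewrite -ler_sqr ?nnegrE ?cmod_ge0 ?addr_ge0 // sqr_cmod sqrrD.
rewrite !real_normK ?num_real // lerD2r lerDl.
by rewrite mulrn_wge0 // mulr_ge0.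
Qed.

Lemma cmod_sum (I : Type) (r : seq I) (P : pred I) (F : I -> R[i]) :
  cmod (\sum_(i <- r | P i) F i) <= \sum_(i <- r | P i) cmod (F i).
Proof.
elim/big_rec2: _ => [|i y x _ H]; first by rewrite (cmod_real 0) normr0.
by rewrite (le_trans (cmodD _ _)) // lerD2l.
Qed.

Lemma Re_sum (I : Type) (r : seq I) (P : pred I) (F : I -> R[i]) :
  Re (\sum_(i <- r | P i) F i) = \sum_(i <- r | P i) Re (F i).
Proof. by elim/big_rec2: _ => [//|i y x _ <-]; case: (F i) x => ? ? []. Qed.

Lemma Im_sum (I : Type) (r : seq I) (P : pred I) (F : I -> R[i]) :
  Im (\sum_(i <- r | P i) F i) = \sum_(i <- r | P i) Im (F i).
Proof. by elim/big_rec2: _ => [//|i y x _ <-]; case: (F i) x => ? ? []. Qed.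

Lemma mul_conj z : z * Num.conj z = (cmod z ^+ 2)%:C.
Proof.
rewrite sqr_cmod; case: z => a b; apply/eqP; rewrite eq_complex /=.
by apply/andP; split; apply/eqP; ring.
Qed.

Definition expi a : R[i] := (cos a) +i* (sin a).

Lemma expi0 : expi 0 = 1.
Proof. by rewrite /expi cos0 sin0. Qed.

Lemma expiD a b : expi (a + b) = expi a * expi b.
Proof.
by apply/eqP; rewrite eq_complex /= cosD sinD eqxx /= addrC [sin a * _]mulrC eqxx.
Qed.

Lemma conj_expi a : Num.conj (expi a) = expi (- a).
Proof. by rewrite /expi cosN sinN. Qed.

Lemma expi_mulN a : expi a * expi (- a) = 1.
Proof. by rewrite -expiD subrr expi0. Qed.

Lemma sqr_cmod_expi_sub a b : cmod (expi a - expi b) ^+ 2 = 2 - 2 * cos (a - b).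
Proof.
rewrite sqr_cmod /= cosB; have := cos2Dsin2 a; have := cos2Dsin2 b; lra.
Qed.

Lemma cmod_expi_sub_le a b : cmod (expi a - expi b) <= `|a - b|.
Proof.
rewrite -ler_sqr ?nnegrE ?cmod_ge0 // sqr_cmod_expi_sub.
rewrite -cos_norm; have := cos_ge_quadratic (normr_ge0 (a - b)); lra.
Qed.

Lemma dist_le_cmod_expi_sub a b : `|a - b| <= pi ->
  `|a - b| <= 3 * cmod (expi a - expi b).
Proof.
move=> H; rewrite -ler_sqr ?nnegrE ?mulr_ge0 ?cmod_ge0 // exprMn.
rewrite sqr_cmod_expi_sub real_normK ?num_real //.
by apply: le_trans (sqr_le_chord H) _; lra.
Qed.

Lemma cmod_expi_taylor_le a :
  cmod (expi a - (1 + 'i * a%:C - (a ^+ 2 / 2)%:C)) <= 2 * `|a| ^+ 3.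
Proof.
apply: le_trans (cmod_le_Re_Im _) _.
rewrite mulr_natl mulr2n; apply: lerD.
  rewrite [X in `|X|](_ : _ = cos a - (1 - a ^+ 2 / 2)).
    exact: normr_cos_sub_quadratic_le.
  by rewrite /=; ring.
rewrite [X in `|X|](_ : _ = - (a - sin a)); last by rewrite /=; ring.
by rewrite normrN normr_sin_sub_id_le.
Qed.

Lemma real_complex_fact_inv p : (p`!%:R : R[i])^-1 = (p`!%:R^-1)%:C.
Proof. by rewrite fmorphV rmorph_nat. Qed.

(** The parities and halves are those of [cos_coeff] and [sin_coeff], so that partial sums of the
    exponential series split into the cosine and sine series. *)
Lemma imaginary_expr a p : ('i * a%:C : R[i]) ^+ p =
  ((~~ odd p)%:R * (-1) ^+ p./2 * a ^+ p) +i* ((odd p)%:R * (-1) ^+ p.-1./2 * a ^+ p).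
Proof.
elim: p => [|p IH]; first by rewrite !expr0 /= !mul1r !mul0r.
rewrite exprS {}IH; apply/eqP; rewrite eq_complex /= !exprS.
case: p => [|p]; first by rewrite /= !expr0; apply/andP; split; apply/eqP; ring.
rewrite /= negbK; case: (odd p) => /=; rewrite ?exprS;
  apply/andP; split; apply/eqP; ring.
Qed.

Lemma near_expi_series a e : 0 < e -> \forall m \near \oo,
  cmod (expi a - \sum_(p < m) (p`!%:R : R[i])^-1 * ('i * a%:C) ^+ p) < e.
Proof.
have hc : series (cos_coeff a) @ \oo --> cos a.
  by rewrite unlock; exact: is_cvg_series_cos_coeff.
have hs : series (sin_coeff a) @ \oo --> sin a.
  by rewrite unlock; exact: is_cvg_series_sin_coeff.
move=> e0; have e2 : 0 < e / 2 by rewrite divr_gt0.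
near=> m.
have -> : \sum_(p < m) (p`!%:R : R[i])^-1 * ('i * a%:C) ^+ p =
   (series (cos_coeff a) m) +i* (series (sin_coeff a) m).
  apply/eqP; rewrite eq_complex Re_sum Im_sum /series /= !big_mkord.
  apply/andP; split; apply/eqP/eq_bigr => p _;
    rewrite real_complex_fact_inv imaginary_expr /= /cos_coeff /sin_coeff /=;
    rewrite -?exprnP; ring.
apply: le_lt_trans (cmod_le_Re_Im _) _ => /=.
rewrite [ltRHS]splitr; apply: ltrD.
  by near: m; move/cvgrPdist_lt: hc; apply.
by near: m; move/cvgrPdist_lt: hs; apply.
Unshelve. all: by end_near.
Qed.

End Complex.

Lemma expmx_eq (K : numFieldType) n (A L : 'M[K]_n) :
  (forall e : K, 0 < e -> \forall m \near \oo, forall k l,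
    `|L k l - (\sum_(p < m) p`!%:R^-1 *: A ^+ p) k l| < e) ->
  expmx A = L.
Proof.
move=> H; apply: cvg_lim; first exact: norm_hausdorff.
apply/cvg_ballP => e e0; near=> m; split => // k l.
by rewrite /series /= big_mkord; move: k l; near: m; exact: H.
Unshelve. all: by end_near.
Qed.

Section UnitaryDiag.
Variables (R : realType) (n : nat).
Implicit Types (U : 'M[R[i]]_n) (f g : 'I_n -> R[i]).

Definition udiag U f : 'M[R[i]]_n := U *m diag_mx (\row_j f j) *m U^t*.

Lemma udiagE U f k l : udiag U f k l = \sum_j U k j * f j * Num.conj (U l j).
Proof.
by rewrite /udiag mxE; apply: eq_bigr => j _; rewrite mul_mx_diag !mxE.
Qed.

Lemma eq_udiag U f g : f =1 g -> udiag U f = udiag U g.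
Proof. by move=> /funext ->. Qed.

Lemma unitarymxK U : U \is unitarymx -> U^t* *m U = 1%:M.
Proof. by rewrite -trmxC_unitary => /unitarymxP; rewrite trmxCK. Qed.

Lemma unitarymxVK U : U \is unitarymx -> U *m U^t* = 1%:M.
Proof. by move/unitarymxP. Qed.

Lemma sum_sqr_cmod_unitarymx U k : U \is unitarymx ->
  \sum_j cmod (U k j) ^+ 2 = 1.
Proof.
move=> /unitarymxP /matrixP /(_ k k); rewrite !mxE eqxx.
under eq_bigr do rewrite !mxE mul_conj.
by rewrite -rmorph_sum => /complexI.
Qed.

Lemma unitarymx_cmod_le1 U k j : U \is unitarymx -> cmod (U k j) <= 1.
Proof.
move=> /(sum_sqr_cmod_unitarymx k) H.
rewrite -ler_sqr ?nnegrE ?cmod_ge0 // expr1n -H (bigD1 j) //= lerDl.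
by apply: sumr_ge0 => i _; exact: sqr_ge0.
Qed.

Lemma udiagM U f g : U \is unitarymx ->
  udiag U f *m udiag U g = udiag U (fun j => f j * g j).
Proof.
move=> Uu; rewrite /udiag !mulmxA -[_ *m U^t* *m U]mulmxA unitarymxK // mulmx1.
rewrite -[U *m _ *m _]mulmxA mulmx_diag; congr (_ *m diag_mx _ *m _).
by apply/rowP => j; rewrite !mxE.
Qed.

Lemma udiag1 U : U \is unitarymx -> udiag U (fun=> 1) = 1%:M.
Proof.
move=> Uu; rewrite /udiag (_ : diag_mx _ = 1%:M) ?mulmx1 ?unitarymxVK //.
by apply/matrixP => i j; rewrite !mxE.
Qed.

Lemma udiagX U f p : U \is unitarymx ->
  udiag U f ^+ p = udiag U (fun j => f j ^+ p).
Proof.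
move=> Uu; elim: p => [|p IH].
  by rewrite expr0 -[LHS](udiag1 Uu); apply: eq_udiag => j; rewrite expr0.
rewrite exprS IH -[LHS]/(_ *m _) udiagM //.
by apply: eq_udiag => j; rewrite exprS.
Qed.

Lemma udiagZ U f (c : R[i]) : c *: udiag U f = udiag U (fun j => c * f j).
Proof.
apply/matrixP => k l; rewrite mxE !udiagE mulr_sumr.
by apply: eq_bigr => j _; ring.
Qed.

Lemma udiag_sum U (I : Type) (r : seq I) (F : I -> 'I_n -> R[i]) :
  \sum_(i <- r) udiag U (F i) = udiag U (fun j => \sum_(i <- r) F i j).
Proof.
apply/matrixP => k l; rewrite summxE udiagE.
under eq_bigr do rewrite udiagE.
rewrite exchange_big; apply: eq_bigr => j _.
by rewrite mulr_sumr mulr_suml.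
Qed.

Lemma udiag_adj U f : (udiag U f)^t* = udiag U (fun j => Num.conj (f j)).
Proof.
apply/matrixP => k l; rewrite [LHS]mxE [X in Num.conj X]mxE !udiagE rmorph_sum.
by apply: eq_bigr => j _; rewrite !rmorphM /= conjCK; ring.
Qed.

Lemma udiag_mul (V U : 'M[R[i]]_n) f : V *m udiag U f *m V^t* = udiag (V *m U) f.
Proof. by rewrite /udiag trmx_mul map_mxM !mulmxA. Qed.

Lemma expmx_udiag U (d : 'I_n -> R) : U \is unitarymx ->
  expmx (udiag U (fun j => 'i * (d j)%:C)) = udiag U (fun j => expi (d j)).
Proof.
move=> Uu; apply: expmx_eq => e e0.
have [e1 eE] : 0 < Re e /\ e = (Re e)%:C.
  by move: e0; rewrite ltcE => /andP[/eqP e1 ?]; split=> //;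
    apply/eqP; rewrite eq_complex e1 !eqxx.
(* With [n.+1] the [n] errors add up to strictly less than [Re e], also when [n = 0]. *)
have e2 : 0 < Re e / n.+1%:R by rewrite divr_gt0.
have H : \forall m \near \oo, forall j, cmod (expi (d j) -
    \sum_(p < m) (p`!%:R : R[i])^-1 * ('i * (d j)%:C) ^+ p) < Re e / n.+1%:R.
  by apply: filter_forall => j; exact: near_expi_series.
near=> m => k l.
have -> : \sum_(p < m) p`!%:R^-1 *: udiag U (fun j => 'i * (d j)%:C) ^+ p =
  udiag U (fun j => \sum_(p < m) (p`!%:R)^-1 * ('i * (d j)%:C) ^+ p).
  by rewrite -udiag_sum; apply: eq_bigr => p _; rewrite udiagX // udiagZ.
rewrite normr_cmod eE ltcR !udiagE -sumrB.
apply: le_lt_trans (cmod_sum _ _ _) _.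
apply: (@le_lt_trans _ _ (\sum_(j < n) Re e / n.+1%:R)).
  apply: ler_sum => j _; rewrite -mulrBl -mulrBr !cmodM cmod_conj.
  have h := unitarymx_cmod_le1 k j Uu; have h' := unitarymx_cmod_le1 l j Uu.
  apply: (@le_trans _ _ (cmod (expi (d j) - \sum_(p < m) (p`!%:R)^-1 * ('i * (d j)%:C) ^+ p))).
    rewrite mulrAC -[leRHS]mul1r ler_wpM2r ?cmod_ge0 //.
    by rewrite mulr_ile1 ?cmod_ge0.
  by apply: ltW; move: j {h h'}; near: m.
rewrite sumr_const card_ord -[ltLHS]mulr_natr mulrAC -mulrA gtr_pMr //.
by rewrite ltr_pdivrMr // mul1r ltr_nat.
Unshelve. all: by end_near.
Qed.

End UnitaryDiag.

(** * Ad-invariant norms *)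

Section SkewHermitian.
Variables (R : realType) (n : nat).
Implicit Types (U v : 'M[R[i]]_n) (d : 'I_n -> R).

(** A skew-Hermitian matrix is normal, so the spectral theorem applies; the diagonal factor is again
    skew-Hermitian, hence purely imaginary. *)
Lemma skew_hermitian_udiag v : v^t* = - v ->
  exists U d, U \is unitarymx /\ v = udiag U (fun j => 'i * (d j)%:C).
Proof.
move=> vN; have /orthomx_spectralP : v \is normalmx.
  by apply/normalmxP; rewrite vN mulmxN mulNmx.
have := spectral_unitarymx v.
set P := spectralmx v; set s := spectral_diag v => Pu vE.
have PU : P^t* \is unitarymx by rewrite trmxC_unitary.
have {}vE : v = udiag (P^t*) (fun j => s 0 j).
  rewrite /udiag trmxCK -(invmx_unitary Pu) {1}vE; congr (_ *m diag_mx _ *m _).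
  by apply/rowP => j; rewrite mxE.
have dE : P *m v *m P^t* = diag_mx s.
  by rewrite vE udiag_mul unitarymxVK // /udiag trmx1 map_mx1 mul1mx mulmx1;
    congr diag_mx; apply/rowP => j; rewrite mxE.
exists (P^t*), (fun j => Im (s 0 j)); split => //.
rewrite {1}vE; apply: eq_udiag => j.
have : (P *m v *m P^t*)^t* = - (P *m v *m P^t*).
  by rewrite !trmx_mul !map_mxM trmxCK vN mulNmx mulmxN mulmxA.
rewrite dE => /matrixP /(_ j j); rewrite !mxE eqxx !mulr1n.
case: (s 0 j) => a b /eqP; rewrite eq_complex /= => /andP[/eqP ab _].
by apply/eqP; rewrite eq_complex /=; apply/andP; split; apply/eqP; lra.
Qed.

(** A crude bound, which shows that the set under the [sup] of [spectral_norm] is bounded above. *)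
Lemma euclidean_norm_ubound v (w : 'cV[R[i]]_n) : euclidean_norm w <= 1 ->
  euclidean_norm (v *m w) <= Num.sqrt (\sum_k (\sum_l cmod (v k l)) ^+ 2).
Proof.
move=> w1; rewrite ler_wsqrtr // ler_sum // => k _.
rewrite ler_sqr ?nnegrE ?cmod_ge0 ?sumr_ge0 // => [|l _]; last exact: cmod_ge0.
rewrite mxE; apply: le_trans (cmod_sum _ _ _) _.
apply: ler_sum => l _; rewrite cmodM ler_piMr ?cmod_ge0 //.
apply: le_trans _ w1; rewrite -[cmod _]ger0_norm ?cmod_ge0 // -sqrtr_sqr.
rewrite ler_wsqrtr // (bigD1 l) //= lerDl sumr_ge0 // => j _; exact: sqr_ge0.
Qed.

(** Column [j] of [U] is a unit eigenvector, hence a competitor in the supremum. *)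
Lemma udiag_le_spectral_norm U d j : U \is unitarymx ->
  `|d j| <= spectral_norm (udiag U (fun j => 'i * (d j)%:C)).
Proof.
move=> Uu; set v := udiag _ _.
have colE : v *m col j U = ('i * (d j)%:C) *: col j U.
  rewrite colE mulmxA /v /udiag -[_ *m U]mulmxA unitarymxK // mulmx1.
  by rewrite -!colE; apply/colP => k; rewrite mxE mul_mx_diag !mxE mulrC.
have col1 : euclidean_norm (col j U) = 1.
  rewrite /euclidean_norm -sqrtr1; congr Num.sqrt.
  have := @sum_sqr_cmod_unitarymx R n U^T j; rewrite trmx_unitary => /(_ Uu) <-.
  by apply: eq_bigr => k _; rewrite !mxE.
rewrite /spectral_norm; apply: ub_le_sup.
  exists (Num.sqrt (\sum_k (\sum_l cmod (v k l)) ^+ 2)) => _ [w /= w1 <-].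
  exact: euclidean_norm_ubound.
exists (col j U); first by rewrite /= col1.
rewrite colE /euclidean_norm -[RHS]mulr1 -col1 /euclidean_norm.
rewrite -sqrtr_sqr -sqrtrM ?sqr_ge0 // mulr_sumr; congr Num.sqrt.
by apply: eq_bigr => k _; rewrite mxE cmodM cmodM cmod_i cmod_real mul1r exprMn
  real_normK ?num_real.
Qed.

End SkewHermitian.

Section AdInvariantNorm.
Variables (R : realType) (n : nat) (N : 'M[R[i]]_n -> R).
Hypotheses (hN : is_norm_on_su N) (hAd : Ad_invariant N).
Implicit Types (U v w : 'M[R[i]]_n) (d e : 'I_n -> R).

Lemma suD v w : su v -> su w -> su (v + w).
Proof.
move=> [v1 v2] [w1 w2]; split; last by rewrite linearD /= v2 w2 addr0.
by rewrite linearD /= map_mxD v1 w1 opprD.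
Qed.

Lemma suZ (a : R) v : su v -> su (a%:C *: v).
Proof.
move=> [v1 v2]; split; last by rewrite linearZ /= v2 mulr0.
rewrite linearZ /= map_mxZ v1 scalerN; congr (- (_ *: _)).
exact: conjc_real.
Qed.

Lemma su0 : su (0 : 'M[R[i]]_n).
Proof. by split; rewrite ?mxtrace0 // trmx0 map_mx0 oppr0. Qed.

Lemma su_conj U v : U \is unitarymx -> su v -> su (U *m v *m U^t*).
Proof.
move=> Uu [v1 v2]; split.
  by rewrite !trmx_mul !map_mxM trmxCK v1 mulNmx mulmxN mulmxA.
by rewrite mxtrace_mulC mulmxA unitarymxK // mul1mx.
Qed.

Lemma su_norm0 : N 0 = 0.
Proof. by rewrite -(scale0r 0) (su_normZ hN 0 su0) normr0 mul0r. Qed.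

(** [Ad_invariant] speaks of determinant 1, while eigenbases have any determinant. Multiplying [U]
    by an [n]-th root of [(\det U)^-1] corrects this; that scalar has modulus 1 and cancels in the
    conjugation. *)
Lemma norm_unitary_conj U v : U \is unitarymx -> su v -> N (U *m v *m U^t*) = N v.
Proof.
move=> Uu sv; have [n0|n0] := posnP n.
  congr N; apply/matrixP => k; have := ltn_ord k; by rewrite {2}n0.
pose c := n.-root (\det U)^-1.
have cn : c ^+ n * \det U = 1.
  rewrite rootCK // mulVf //.
  by have := unitarymx_unit Uu; rewrite unitmxE unitfE.
have c1 : cmod c = 1.
  have := congr1 cmod cn; rewrite cmodM.
  have -> : cmod (\det U) = 1.
    have /(congr1 determinant) := unitarymxVK Uu.
    rewrite det_mulmx det1 det_map_mx det_tr mul_conj => /complexI /eqP.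
    by rewrite sqrp_eq1 ?cmod_ge0 // => /eqP.
  rewrite mulr1 (_ : cmod (c ^+ n) = cmod c ^+ n); last first.
    elim: (n) => [|m IH]; first by rewrite !expr0 (cmod_real 1) normr1.
    by rewrite !exprS cmodM IH.
  rewrite (cmod_real 1) normr1 => /eqP.
  by rewrite pexpr_eq1 // ?cmod_ge0 // => /eqP.
have cc : c * Num.conj c = 1 by rewrite mul_conj c1 expr1n.
have Wadj : (c *: U)^t* = Num.conj c *: U^t*.
  by apply/matrixP => k l; rewrite !mxE rmorphM.
have Wu : c *: U \is unitarymx.
  apply/unitarymxP; rewrite Wadj -scalemxAl -scalemxAr scalerA cc scale1r.
  exact: unitarymxVK.
have WSU : SU (c *: U) by split; rewrite // detZ.
rewrite -(hAd WSU sv) invmx_unitary // Wadj -!scalemxAl -scalemxAr scalerA.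
by rewrite cc scale1r.
Qed.

Definition idiag d : 'M[R[i]]_n := diag_mx (\row_j ('i * (d j)%:C)).

Lemma idiagE d k l : idiag d k l = if k == l then 'i * (d k)%:C else 0.
Proof. by rewrite !mxE; case: eqP => [->|]. Qed.

Lemma udiag_idiag U d : udiag U (fun j => 'i * (d j)%:C) = U *m idiag d *m U^t*.
Proof. by []. Qed.

Lemma su_idiag d : \sum_j d j = 0 -> su (idiag d).
Proof.
move=> d0; split.
  apply/matrixP => k l; rewrite mxE mxE !mxE [l == k]eq_sym.
  case: eqP => [->|_]; rewrite ?mulr1n ?mulr0n ?oppr0 ?rmorph0 //.
  by apply/eqP; rewrite eq_complex /=; apply/andP; split; apply/eqP; ring.
rewrite mxtrace_diag; under eq_bigr do rewrite mxE.
by rewrite -mulr_sumr -rmorph_sum d0 mulr0.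
Qed.

Lemma su_udiag_sum0 U d : U \is unitarymx ->
  su (udiag U (fun j => 'i * (d j)%:C)) -> \sum_j d j = 0.
Proof.
move=> Uu [_]; rewrite udiag_idiag mxtrace_mulC mulmxA unitarymxK // mul1mx.
rewrite mxtrace_diag; under eq_bigr do rewrite mxE.
rewrite -mulr_sumr -rmorph_sum => /eqP; rewrite mulf_eq0 => /orP[].
  by rewrite eq_complex /= oner_eq0 andbF.
by move=> /eqP /complexI.
Qed.

(** By unitary invariance [N] depends only on the eigenvalues. This is [N] as a function of them: a
    permutation-invariant norm on real vectors of sum 0. *)
Definition diagN d := N (idiag d).

Lemma norm_udiag U d : U \is unitarymx -> \sum_j d j = 0 ->
  N (udiag U (fun j => 'i * (d j)%:C)) = diagN d.
Proof. by move=> Uu d0; rewrite udiag_idiag norm_unitary_conj //; exact: su_idiag. Qed.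

Lemma eq_diagN d e : d =1 e -> diagN d = diagN e.
Proof. by move=> /funext ->. Qed.

Lemma diagN_ge0 d : \sum_j d j = 0 -> 0 <= diagN d.
Proof. by move=> d0; apply: (su_norm_ge0 hN); exact: su_idiag. Qed.

Lemma diagND d e : \sum_j d j = 0 -> \sum_j e j = 0 ->
  diagN (fun j => d j + e j) <= diagN d + diagN e.
Proof.
move=> d0 e0; rewrite /diagN.
have -> : idiag (fun j => d j + e j) = idiag d + idiag e.
  apply/matrixP => k l; rewrite [RHS]mxE !idiagE; case: eqP; rewrite ?addr0 //.
  by rewrite rmorphD mulrDr.
by apply: (su_normD hN); exact: su_idiag.
Qed.

Lemma diagNZ (a : R) d : \sum_j d j = 0 ->
  diagN (fun j => a * d j) = `|a| * diagN d.
Proof.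
move=> d0; rewrite /diagN -(su_normZ hN); last exact: su_idiag.
congr N; apply/matrixP => k l; rewrite [RHS]mxE !idiagE.
by case: eqP; rewrite ?mulr0 // rmorphM mulrCA.
Qed.

Lemma diagN0 : diagN (fun=> 0) = 0.
Proof.
rewrite -[RHS]su_norm0; congr N; apply/matrixP => k l.
by rewrite idiagE !mxE mulr0 if_same.
Qed.

Lemma diagN_sum (I : Type) (r : seq I) (c : I -> R) (F : I -> 'I_n -> R) :
  (forall i, \sum_j F i j = 0) ->
  diagN (fun j => \sum_(i <- r) c i * F i j) <= \sum_(i <- r) `|c i| * diagN (F i).
Proof.
move=> F0; elim: r => [|i r IH].
  by rewrite big_nil (@eq_diagN _ (fun=> 0)) ?diagN0 // => j; rewrite big_nil.
rewrite big_cons (@eq_diagN _ (fun j => c i * F i j + \sum_(i <- r) c i * F i j)).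
  apply: le_trans (diagND _ _) _.
  - by rewrite -mulr_sumr F0 mulr0.
  - by rewrite exchange_big big1 // => k _; rewrite -mulr_sumr F0 mulr0.
  - by rewrite diagNZ // lerD2l.
by move=> j; rewrite big_cons.
Qed.

Lemma diagN_tperm d j k : \sum_i d i = 0 -> diagN (fun i => d (tperm j k i)) = diagN d.
Proof.
move=> d0; have Pu : perm_mx (tperm j k) \is @unitarymx R[i] n n.
  apply/unitarymxP; rewrite tr_perm_mx map_perm_mx -perm_mxM mulgV perm_mx1 //.
rewrite -[RHS](norm_unitary_conj Pu (su_idiag d0)) tr_perm_mx map_perm_mx tpermV.
congr N; rewrite -row_permE -[tperm j k in RHS]tpermV -col_permE.
apply/matrixP => a b; rewrite [RHS]mxE [RHS]mxE !idiagE.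
by rewrite tpermV (inj_eq perm_inj).
Qed.

(** Since the entries sum to 0, [d] is the combination, with coefficients [d j], of the vectors
    [e j], the differences of the [j]-th and a fixed unit vector. The triangle inequality does the
    rest. *)
Lemma diagN_bounded : exists2 K, 0 <= K & forall d B, \sum_j d j = 0 ->
  (forall j, `|d j| <= B) -> diagN d <= K * B.
Proof.
have [n0|n0] := posnP n.
  exists 0 => // d B _ _; rewrite mul0r (@eq_diagN _ (fun=> 0)) ?diagN0 //.
  by move=> j; have := ltn_ord j; rewrite {2}n0.
pose o := Ordinal n0.
pose e (j k : 'I_n) : R := (j == k)%:R - (o == k)%:R.
have s1 (j : 'I_n) : \sum_k ((j == k)%:R : R) = 1.
  by rewrite (bigD1 j) //= eqxx big1 ?addr0 // => i; rewrite eq_sym => /negbTE ->.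
have e0 j : \sum_k e j k = 0 by rewrite sumrB !s1 subrr.
exists (\sum_j diagN (e j)).
  by rewrite sumr_ge0 // => j _; exact: diagN_ge0.
move=> d B d0 dB; rewrite (@eq_diagN _ (fun k => \sum_j d j * e j k)).
  apply: le_trans (diagN_sum _ _ e0) _; rewrite mulr_suml.
  by apply: ler_sum => j _; rewrite mulrC ler_wpM2l ?diagN_ge0.
move=> k; under eq_bigr do rewrite mulrBr.
rewrite sumrB -mulr_suml d0 mul0r subr0 (bigD1 k) //= eqxx mulr1.
by rewrite big1 ?addr0 // => i /negbTE ->; rewrite mulr0.
Qed.

(** Each eigenvalue is a diagonal entry of [v] in an eigenbasis, a sum of [n ^ 2] terms of modulus
    at most [B]. *)
Lemma norm_bounded : exists2 K, 0 <= K & forall v B, su v ->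
  (forall k l, cmod (v k l) <= B) -> N v <= K * B.
Proof.
have [K K0 HK] := diagN_bounded.
exists (K * (n ^ 2)%:R); first by rewrite mulr_ge0.
move=> v B sv vB; have [vN _] := sv.
have [U [d [Uu vE]]] := skew_hermitian_udiag vN.
have d0 : \sum_j d j = 0 by apply: (@su_udiag_sum0 U) => //; rewrite -vE.
rewrite vE norm_udiag // -mulrA; apply: HK => // j.
have : (U^t* *m v *m U) j j = 'i * (d j)%:C.
  rewrite vE udiag_idiag !mulmxA unitarymxK // mul1mx -mulmxA unitarymxK // mulmx1.
  by rewrite idiagE eqxx.
move=> /(congr1 cmod); rewrite [in RHS]cmodM cmod_i cmod_real mul1r => <-.
rewrite mxE; apply: le_trans (cmod_sum _ _ _) _.
rewrite -mulnn natrM -mulrA mulr_natl -[X in _ <= _ *+ X]card_ord -sumr_const.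
apply: ler_sum => l _; rewrite cmodM mxE.
apply: (@le_trans _ _ (cmod (\sum_k U^t* j k * v k l))).
  by rewrite ler_piMr ?cmod_ge0 // unitarymx_cmod_le1.
apply: le_trans (cmod_sum _ _ _) _.
rewrite mulr_natl -[X in _ <= _ *+ X]card_ord -sumr_const.
apply: ler_sum => k _; rewrite cmodM (le_trans _ (vB k l)) // ler_piMl ?cmod_ge0 //.
by rewrite unitarymx_cmod_le1 // trmxC_unitary.
Qed.

End AdInvariantNorm.

(** * Pinching to the diagonal and spreading of eigenvalues *)

Section Pinching.
Variables (R : realType) (n : nat) (N : 'M[R[i]]_n -> R).
Hypotheses (hN : is_norm_on_su N) (hAd : Ad_invariant N).
Implicit Types (U v w : 'M[R[i]]_n) (d e : 'I_n -> R).

(** The determinant is -1, so invariance under it comes from [norm_unitary_conj] and not directly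
    from [hAd]. *)
Definition reflection (a : 'I_n) : 'M[R[i]]_n :=
  diag_mx (\row_j (if j == a then -1 else 1)).

Lemma reflection_adj a : (reflection a)^t* = reflection a.
Proof.
rewrite /reflection tr_diag_mx map_diag_mx; congr diag_mx; apply/rowP => j.
by rewrite !mxE; case: ifP => _; rewrite ?rmorphN rmorph1.
Qed.

Lemma reflection_unitary a : reflection a \is unitarymx.
Proof.
apply/unitarymxP; rewrite reflection_adj; apply/matrixP => k l.
rewrite mul_mx_diag !mxE; have [->|kl] := eqVneq k l; last by rewrite mulr0n mul0r.
by rewrite !mulr1n; case: ifP => _; rewrite ?mulrNN mulr1.
Qed.

(** The list [s] makes an induction possible: it holds the indices whose row and column have already
    been cleared off the diagonal. *)
Definition pinch (s : seq 'I_n) v : 'M[R[i]]_n :=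
  \matrix_(k, l) if (k != l) && ((k \in s) || (l \in s)) then 0 else v k l.

(** Conjugation by [reflection a] negates exactly the off-diagonal entries of row and column [a], so
    averaging erases them. *)
Lemma pinch_cons a s v : pinch (a :: s) v =
  (2^-1)%:C *: (pinch s v + reflection a *m pinch s v *m (reflection a)^t*).
Proof.
have rE w k l : (reflection a *m w *m reflection a) k l =
    (if k == a then -1 else 1) * w k l * (if l == a then -1 else 1).
  by rewrite mul_mx_diag mxE mul_diag_mx mxE !mxE.
apply/matrixP => k l; rewrite reflection_adj [RHS]mxE [X in _ * X]mxE rE !mxE !inE.
have h z : z = (2^-1)%:C * (z + z) :> R[i].
  case: z => x y; apply/eqP; rewrite eq_complex /=.
  by apply/andP; split; apply/eqP; field.
have [<-|kl] := eqVneq k l => /=.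
  case: (k == a) => /=; last by rewrite mul1r mulr1 -h.
  by rewrite mulN1r mulrN1 opprK -h.
case: ((k \in s) || (l \in s)) (orbACA (k == a) (k \in s) (l == a) (l \in s)) => [|] ->.
  by rewrite orbT mulr0 mul0r addr0 mulr0.
rewrite orbF; case: (eqVneq k a) kl => [->|ka] /=.
  by rewrite eq_sym => /negbTE ->; rewrite mulN1r mulr1 subrr mulr0.
by move=> _; case: eqP => _ /=; rewrite mul1r ?mulrN1 ?subrr ?mulr0 // mulr1 -h.
Qed.

Lemma norm_pinch s v : su v -> su (pinch s v) /\ N (pinch s v) <= N v.
Proof.
move=> sv; elim: s => [|a s [IHs IHN]].
  by have -> : pinch [::] v = v by apply/matrixP => k l; rewrite mxE andbF.
have sr := su_conj (reflection_unitary a) IHs.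
have ss := suD IHs sr; rewrite pinch_cons; split; first exact: suZ.
rewrite (su_normZ hN) // ger0_norm ?invr_ge0 // ler_pdivrMl //.
apply: le_trans (su_normD hN IHs sr) _.
rewrite (norm_unitary_conj hAd) //; last exact: reflection_unitary.
by rewrite mulr_natl mulr2n lerD.
Qed.

Lemma diagN_diagonal_le v : su v ->
  \sum_k Im (v k k) = 0 /\ diagN N (fun k => Im (v k k)) <= N v.
Proof.
move=> sv; have [_ HN] := norm_pinch (enum 'I_n) sv.
have [vN vtr] := sv.
split; first by move/(congr1 (@complex.Im _)): vtr; rewrite /mxtrace Im_sum.
rewrite (_ : diagN _ _ = N (pinch (enum 'I_n) v)) //; congr N.
apply/matrixP => k l; rewrite idiagE mxE !mem_enum !inE andbT.
case: eqP => [<-|//] /=; move/matrixP/(_ k k): vN; rewrite !mxE.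
case: (v k k) => a b /eqP; rewrite eq_complex /= => /andP[/eqP ab _].
by apply/eqP; rewrite eq_complex /=; apply/andP; split; apply/eqP; lra.
Qed.

(* [th - s *: a] is, for small [s], a convex combination of [th] and of its
   transposed copies, so the convex function [s |-> diagN (th + s *: a)] has
   not decreased when [s] runs from [0] upwards. *)
Lemma diagN_le_spread (th : 'I_n -> R) (m : 'I_n -> 'I_n -> R) (s : R) :
  \sum_k th k = 0 -> (forall k l, m k l = m l k) -> (forall k l, 0 <= m k l) ->
  0 <= s ->
  diagN N th <= diagN N (fun k => th k + s * \sum_l m k l * (th k - th l)).
Proof.
move=> th0 mC m0 s0; pose a k := \sum_l m k l * (th k - th l).
pose M := \sum_(p : 'I_n * 'I_n) m p.1 p.2.
have M0 : 0 <= M by apply: sumr_ge0 => p _; exact: m0.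
pose F (p : 'I_n * 'I_n) i := th (tperm p.1 p.2 i).
have F0 p : \sum_i F p i = 0.
  by rewrite -[RHS]th0 [RHS](reindex_inj (@perm_inj _ (tperm p.1 p.2))).
(* A transposition changes entry [i] only if it moves [i]. In an ordered pair [i] can stand in
   either place, whence the factor 2. *)
have sumF i : \sum_p m p.1 p.2 * F p i = M * th i - 2 * a i.
  suff : \sum_p m p.1 p.2 * (F p i - th i) = - 2 * a i.
    under eq_bigr do rewrite mulrBr; rewrite sumrB -mulr_suml -/M; lra.
  rewrite -(pair_bigA _ (fun j k => m j k * (F (j, k) i - th i))) /=.
  have e j k : m j k * (F (j, k) i - th i) =
      (if j == i then m i k * (th k - th i) else 0)
    + (if k == i then m i j * (th j - th i) else 0).
    rewrite /F /= permE /= ![i == _]eq_sym (mC i j).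
    by case: (eqVneq j i) => [->|ji]; case: (eqVneq k i) => [->|ki]; rewrite ?subrr; ring.
  under eq_bigr => j _ do under eq_bigr => k _ do rewrite e.
  under eq_bigr do rewrite big_split /=; rewrite big_split /=.
  have -> : \sum_j \sum_k (if j == i then m i k * (th k - th i) else 0) = - a i.
    rewrite (bigD1 i) //= eqxx [X in _ + X]big1 ?addr0 => [|j /negbTE ->]; last by rewrite big1.
    by rewrite /a -sumrN; apply: eq_bigr => k _; ring.
  rewrite exchange_big /=.
  have -> : \sum_j \sum_k (if j == i then m i k * (th k - th i) else 0) = - a i.
    rewrite (bigD1 i) //= eqxx [X in _ + X]big1 ?addr0 => [|j /negbTE ->]; last by rewrite big1.
    by rewrite /a -sumrN; apply: eq_bigr => k _; ring.
  ring.
have a0 : \sum_k a k = 0.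
  have : \sum_i \sum_p m p.1 p.2 * F p i = \sum_i (M * th i - 2 * a i).
    by apply: eq_bigr => i _; exact: sumF.
  rewrite exchange_big big1 => [|p _]; last by rewrite -mulr_sumr F0 mulr0.
  by rewrite sumrB -!mulr_sumr th0; lra.
have M1 : 0 < M + 1 by lra.
(* Averaging [th], with weight 1, and its transposed copies, with weights [m], yields [th - s0' a]
   by [sumF]. The weight 1 keeps the total positive even if [m] vanishes. *)
pose s0' := 2 / (M + 1).
have s0'0 : 0 < s0' by rewrite divr_gt0.
have ths t : \sum_k (th k + t * a k) = 0.
  by rewrite big_split /= -mulr_sumr th0 a0 mulr0 addr0.
have inward : diagN N (fun k => th k + (- s0') * a k) <= diagN N th.
  rewrite (@eq_diagN _ _ _ _ (fun k => (M + 1)^-1 * th k +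
      (M + 1)^-1 * \sum_p m p.1 p.2 * F p k)); last first.
    by move=> k; rewrite sumF /s0'; field; lra.
  apply: le_trans (diagND hN _ _) _.
  - by rewrite -mulr_sumr th0 mulr0.
  - rewrite -mulr_sumr exchange_big big1 ?mulr0 // => p _.
    by rewrite -mulr_sumr F0 mulr0.
  rewrite diagNZ // diagNZ //; last first.
    by rewrite exchange_big big1 // => p _; rewrite -mulr_sumr F0 mulr0.
  rewrite ger0_norm ?invr_ge0 ?(ltW M1) // -mulrDr ler_pdivrMl // mulrDl mul1r addrC lerD2r.
  apply: le_trans (diagN_sum hN _ _ F0) _.
  rewrite /M mulr_suml; apply: ler_sum => p _.
  by rewrite ger0_norm // diagN_tperm.
have key : (s + s0') * diagN N th <=
    s0' * diagN N (fun k => th k + s * a k) + s * diagN N th.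
  rewrite -[X in X * _ <= _]ger0_norm; last by lra.
  rewrite -diagNZ // (@eq_diagN _ _ _ _ (fun k => s0' * (th k + s * a k) +
      s * (th k + (- s0') * a k))); last by move=> k; ring.
  apply: le_trans (diagND hN _ _) _; try by rewrite -mulr_sumr ths mulr0.
  rewrite !diagNZ // !ger0_norm ?(ltW s0'0) // lerD2l.
  by apply: ler_wpM2l.
rewrite -(ler_pM2l s0'0); move: key; rewrite mulrDl /a; lra.
Qed.

End Pinching.

(** * Power bounds and scalar remainders *)

Section PowerBounds.
Variables (R : realType) (D : R -> Prop).
Hypothesis D1 : forall h, D h -> `|h| <= 1.
Implicit Types (F G : R -> R[i]) (p q : nat).

(** [F] is [O(h ^+ p)] uniformly on [D], the set of admissible increments, which is one-sided when
    the base point is an endpoint. *)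
Definition powO p F := exists K, forall h, D h -> cmod (F h) <= K * `|h| ^+ p.

Lemma powO_eq p F G : (forall h, D h -> F h = G h) -> powO p F -> powO p G.
Proof. by move=> FG [K HK]; exists K => h Dh; rewrite -FG // HK. Qed.

Lemma powO_le p F G (c : R) : (forall h, D h -> cmod (F h) <= c * cmod (G h)) ->
  0 <= c -> powO p G -> powO p F.
Proof.
move=> FG c0 [K HK]; exists (c * K) => h Dh; apply: le_trans (FG h Dh) _.
by rewrite -mulrA ler_wpM2l // HK.
Qed.

Lemma powO_weaken p q F : (p <= q)%N -> powO q F -> powO p F.
Proof.
move=> pq [K HK]; exists `|K| => h Dh; apply: le_trans (HK h Dh) _.
apply: (@le_trans _ _ (`|K| * `|h| ^+ q)).
  by rewrite ler_wpM2r ?exprn_ge0 // ler_norm.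
by rewrite ler_wpM2l // ler_wiXn2l // D1.
Qed.

Lemma powOD p F G : powO p F -> powO p G -> powO p (fun h => F h + G h).
Proof.
move=> [K HK] [L HL]; exists (K + L) => h Dh; apply: le_trans (cmodD _ _) _.
by rewrite mulrDl lerD ?HK ?HL.
Qed.

Lemma powON p F : powO p F -> powO p (fun h => - F h).
Proof. by move=> [K HK]; exists K => h Dh; rewrite cmodN HK. Qed.

Lemma powOB p F G : powO p F -> powO p G -> powO p (fun h => F h - G h).
Proof. by move=> HF HG; apply: powOD => //; exact: powON. Qed.

Lemma powOM p q F G : powO p F -> powO q G -> powO (p + q) (fun h => F h * G h).
Proof.
move=> [K HK] [L HL]; exists (K * L) => h Dh; rewrite cmodM exprD mulrACA.
by rewrite ler_pM ?cmod_ge0 ?HK ?HL.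
Qed.

Lemma powO_cst p (c : R[i]) F : powO p F -> powO p (fun h => c * F h).
Proof.
by apply: powO_le; [move=> h _; rewrite cmodM|exact: cmod_ge0].
Qed.

Lemma powO_0 F (c : R) : (forall h, D h -> cmod (F h) <= c) -> powO 0 F.
Proof. by move=> H; exists c => h Dh; rewrite expr0 mulr1 H. Qed.

Lemma powO_conj p F : powO p F -> powO p (fun h => Num.conj (F h)).
Proof. by move=> [K HK]; exists K => h Dh; rewrite cmod_conj HK. Qed.

Lemma powO_sum p (I : Type) (r : seq I) (F : I -> R -> R[i]) :
  (forall i, powO p (F i)) -> powO p (fun h => \sum_(i <- r) F i h).
Proof.
move=> HF; elim: r => [|i r IH].
  by exists 0 => h _; rewrite big_nil mul0r (cmod_real 0) normr0.
by apply: powO_eq (powOD (HF i) IH) => h _; rewrite big_cons.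
Qed.

Lemma powO_X p (c : R[i]) : powO p (fun h => c * (h ^+ p)%:C).
Proof.
by apply: powO_cst; exists 1 => h _; rewrite cmod_real normrX mul1r.
Qed.

Lemma powO_Im p F : powO p F -> powO p (fun h => (Im (F h))%:C).
Proof.
by apply: (@powO_le _ _ _ 1) => // h _; rewrite cmod_real mul1r normr_Im_le.
Qed.

End PowerBounds.

Section ScalarRemainders.
Variable R : realType.
Implicit Types a b : R.

(* Inverting [0] gives [0], so [chi 0 = 0], the value that makes [chi] continuous. *)
Definition chi a : R := (a - sin a) / a ^+ 2.

Lemma sqr_mul_chi a : a ^+ 2 * chi a = a - sin a.
Proof.
rewrite /chi; have [->|a0] := eqVneq a 0; first by rewrite sin0; ring.
by field.
Qed.

Lemma normr_chi_le a : `|chi a| <= `|a|.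
Proof.
have [->|a0] := eqVneq a 0; first by rewrite /chi sin0 subrr mul0r.
rewrite /chi normrM normfV ler_pdivrMr ?normr_gt0 ?expf_neq0 // normrX -exprS.
exact: normr_sin_sub_id_le.
Qed.

Lemma normr_sinB_le a b : `|sin a - sin b| <= `|a - b|.
Proof. exact: le_trans (normr_Im_le (expi a - expi b)) (cmod_expi_sub_le a b). Qed.

(** Comparison with a fixed point [b] suffices, so the constant may blow up as [b] tends to 0. The
    bound 4 covers every difference of two angles below [pi / 2]. *)
Lemma chi_lipschitz b : `|b| <= 4 -> exists2 K, 0 <= K &
  forall a, `|a| <= 4 -> `|chi a - chi b| <= K * `|a - b|.
Proof.
move=> b4; have [->|b0] := eqVneq b 0.
  exists 1 => // a _; rewrite mul1r subr0 {2}/chi sin0 subrr mul0r subr0.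
  exact: normr_chi_le.
have b20 : 0 < b ^+ 2 by rewrite exprn_even_gt0.
(* Here 32 = 4 * 8 bounds [chi a * (b + a)], and 2 is the sum of the Lipschitz constants of the
   identity and the sine. *)
exists (34 / b ^+ 2) => [|a a4]; first by rewrite divr_ge0 ?ltW.
have -> : chi a - chi b = (chi a * (b + a) * (b - a) +
    (a - b - (sin a - sin b))) / b ^+ 2.
  have := sqr_mul_chi a; have := sqr_mul_chi b.
  move: (chi a) (chi b) => ca cb hb ha.
  apply: (mulIf (lt0r_neq0 b20)); rewrite mulfVK ?lt0r_neq0 //; lra.
rewrite normrM normfV (ger0_norm (ltW b20)) [34 / _ * _]mulrAC ler_pM2r ?invr_gt0 //.
have -> : 34 * `|a - b| = 32 * `|a - b| + 2 * `|a - b| by ring.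
apply: le_trans (ler_normD _ _) (lerD _ _).
  rewrite normrM (distrC b) ler_wpM2r // normrM.
  have -> : 32 = 4 * 8 :> R by ring.
  apply: ler_pM => //; first exact: le_trans (normr_chi_le a) a4.
  by apply: le_trans (ler_normD _ _) _; lra.
apply: le_trans (ler_normB _ _) _; have := normr_sinB_le a b; lra.
Qed.

(** The function [expi a - 1] minus its chord between [0] and [b] vanishes at both ends, hence the
    product of two distances: each will supply one order of smallness. *)
Lemma chord_quotient_remainder a b : b != 0 ->
  cmod (expi a - 1 - (a / b)%:C * (expi b - 1)) <= 2 / `|b| * (`|a| * `|a - b|).
Proof.
move=> b0.
have -> : expi a - 1 - (a / b)%:C * (expi b - 1) =
  (b^-1)%:C * ((b - a)%:C * (expi a - 1) + a%:C * (expi a - expi b)).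
  have e : (b^-1)%:C * b%:C = 1 :> R[i] by rewrite -rmorphM mulVf.
  rewrite rmorphM rmorphB.
  transitivity ((b^-1)%:C * b%:C * (expi a - 1) - a%:C * (b^-1)%:C * (expi b - 1)).
    by rewrite e mul1r.
  ring.
rewrite cmodM cmod_real normfV [2 / _]mulrC -mulrA ler_wpM2l ?invr_ge0 //.
apply: le_trans (cmodD _ _) _; rewrite !cmodM !cmod_real mulr_natl mulr2n.
apply: lerD; last by rewrite ler_wpM2l // cmod_expi_sub_le.
rewrite distrC mulrC ler_wpM2r // -{1}expi0.
by apply: le_trans (cmod_expi_sub_le _ _) _; rewrite subr0.
Qed.

(** For [0 < |b| <= pi], [mu b * b] is [cot (b / 2) / 2 - b cot (b / 2) ^ 2 / 4]: the second-order
    shift of an eigenvalue, less the part due to the off-diagonal entries that pinching discards.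
    The default [mu 0 = 0] is harmless, being multiplied by [th k - th l = 0]. *)
Definition mu b : R := (2 * sin b - b * (1 + cos b)) / (4 * b * (1 - cos b)).

Lemma muN b : mu (- b) = mu b.
Proof.
by rewrite /mu sinN cosN -[in RHS]mulrNN -invrN; congr (_ * _^-1); ring.
Qed.

Lemma mu_ge0 b : `|b| <= pi -> 0 <= mu b.
Proof.
wlog b0 : b / 0 <= b => [H bpi|].
  have [/H|/ltW b0] := leP 0 b; first exact.
  by rewrite -muN H ?oppr_ge0 // normrN.
rewrite ger0_norm // => bpi; rewrite divr_ge0 //.
  by rewrite subr_ge0 mul_1Dcos_le_2sin // b0.
by rewrite !mulr_ge0 // subr_ge0 cos_le1.
Qed.

End ScalarRemainders.

(** * Second-order expansion of the logarithm *)

Section OneParameterGroup.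
Variables (R : realType) (n : nat) (D : R -> Prop).
Variables (S : 'M[R[i]]_n) (x : 'I_n -> R).

Lemma conj_udiag_real k l :
  Num.conj (udiag S (fun j => (x j)%:C) l k) = udiag S (fun j => (x j)%:C) k l.
Proof.
rewrite !udiagE conj_sum; apply: eq_bigr => j _.
by rewrite !conjM conjCK conj_real; ring.
Qed.

Lemma one_parameter_group_expansion k l : S \is unitarymx ->
  powO D 3 (fun h => (udiag S (fun j => expi (h / 2 * x j)) - 1%:M) k l -
    ('i * (h / 2)%:C * udiag S (fun j => (x j)%:C) k l -
     (h ^+ 2 / 8)%:C *
       (udiag S (fun j => (x j)%:C) *m udiag S (fun j => (x j)%:C)) k l)).
Proof.
move=> Su; rewrite udiagM //.
apply: (@powO_eq _ _ _ (fun h => \sum_j (S k j * Num.conj (S l j)) *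
  (expi (h / 2 * x j) - (1 + 'i * (h / 2 * x j)%:C - ((h / 2 * x j) ^+ 2 / 2)%:C)))).
  move=> h _.
  have -> : (udiag S (fun j => expi (h / 2 * x j)) - 1%:M) k l =
      udiag S (fun j => expi (h / 2 * x j)) k l - udiag S (fun=> 1) k l.
    by rewrite udiag1 // [LHS]mxE [X in _ + X]mxE.
  do 4! rewrite udiagE.
  rewrite !mulr_sumr -!sumrB; apply: eq_bigr => j _.
  have -> : (h / 2 * x j) ^+ 2 / 2 = h ^+ 2 / 8 * (x j * x j) by field.
  by rewrite !real_complexM; ring.
apply: powO_sum => j; apply: powO_cst.
exists (2 * `|x j| ^+ 3) => h Dh; apply: le_trans (cmod_expi_taylor_le _) _.
rewrite -[leRHS]mulrA ler_pM2l // normrM exprMn mulrC ler_wpM2l ?exprn_ge0 //.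
rewrite lerXn2r ?nnegrE // normrM ler_piMr // normfV ger0_norm //; lra.
Qed.

End OneParameterGroup.

(** * Diagonal of the logarithm of the symmetric product *)

Section DiagonalExpansion.
Variables (R : realType) (n : nat) (D : R -> Prop).
Hypothesis D1 : forall h, D h -> `|h| <= 1.
Variables (th : 'I_n -> R) (X V : 'M[R[i]]_n) (w : R -> 'M[R[i]]_n).
Variables (U : R -> 'M[R[i]]_n) (d : R -> 'I_n -> R).
Hypothesis thpi : forall k, `|th k| < pi / 2.
Hypothesis VE : V = diag_mx (\row_j expi (th j)).
Hypothesis X_adj : forall k l, Num.conj (X l k) = X k l.
Hypothesis w3 : forall k l, powO D 3 (fun h => (w h - 1%:M) k l -
  ('i * (h / 2)%:C * X k l - (h ^+ 2 / 8)%:C * (X *m X) k l)).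
Hypothesis Uu : forall h, D h -> U h \is unitarymx.
Hypothesis dpi : forall h j, D h -> `|d h j| < pi / 2.
Hypothesis UdE : forall h, D h ->
  udiag (U h) (fun j => expi (d h j)) = w h *m V *m w h.

Local Notation powO := (powO D).
Local Notation cj := Num.conj.
Local Notation Y := (X *m X).
Local Notation B h := (w h - 1%:M).
Local Notation wVw h := (w h *m V *m w h).

Let B2 k l : powO 2 (fun h => (B h) k l - 'i * (h / 2)%:C * X k l).
Proof.
apply: (@powO_eq _ _ _ (fun h => ((B h) k l -
    ('i * (h / 2)%:C * X k l - (h ^+ 2 / 8)%:C * Y k l))
  - (Y k l * (8^-1)%:C) * (h ^+ 2)%:C)); last first.
  by apply: powOB; [exact: powO_weaken (w3 k l)|exact: powO_X].
by move=> h _; rewrite real_complexM; ring.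
Qed.

Let B1 k l : powO 1 (fun h => (B h) k l).
Proof.
apply: (@powO_eq _ _ _ (fun h => ((B h) k l - 'i * (h / 2)%:C * X k l)
   + ('i * X k l * (2^-1)%:C) * (h ^+ 1)%:C)); last first.
  by apply: powOD; [exact: powO_weaken (B2 k l)|exact: powO_X].
by move=> h _; rewrite expr1 real_complexM; ring.
Qed.

Let wVwE h l k : (wVw h) l k = V l k + (expi (th l) * (B h) l k + (B h) l k * expi (th k)
  + \sum_m (B h) l m * expi (th m) * (B h) m k).
Proof.
have wE : w h = 1%:M + B h by rewrite addrC subrK.
have -> : wVw h = V + (V *m B h + B h *m V + B h *m V *m B h).
  rewrite {1 2}wE; move: (B h) => b.
  by rewrite mulmxDl mulmxDr mul1mx !mulmxDl !mulmx1 -!addrA [b *m V + _]addrCA.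
have addE (P Q : 'M[R[i]]_n) : (P + Q) l k = P l k + Q l k by rewrite mxE.
move: (B h) => b; rewrite !addE; congr (_ + (_ + _ + _)).
- by rewrite VE mul_diag_mx !mxE.
- by rewrite VE mul_mx_diag !mxE.
- by rewrite mxE; apply: eq_bigr => m _; rewrite VE mul_mx_diag !mxE.
Qed.

(** In the quadratic term [B V B] only the first-order part of each factor counts: the difference of
    the two products telescopes into terms of order 2 + 1 and 1 + 2. *)
Let wVw3 l k : powO 3 (fun h => (wVw h) l k - (V l k
  + ('i * (h / 2)%:C * X l k - (h ^+ 2 / 8)%:C * Y l k) * (expi (th k) + expi (th l))
  - (h ^+ 2 / 4)%:C * \sum_m X l m * expi (th m) * X m k)).
Proof.
apply: (@powO_eq _ _ _ (fun h =>
    (expi (th k) + expi (th l)) *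
      ((B h) l k - ('i * (h / 2)%:C * X l k - (h ^+ 2 / 8)%:C * Y l k))
  + \sum_m expi (th m) * (((B h) l m - 'i * (h / 2)%:C * X l m) * (B h) m k
     + ('i * 2^-1%:C * X l m * (h ^+ 1)%:C) * ((B h) m k - 'i * (h / 2)%:C * X m k)))).
  move=> h _; rewrite wVwE.
  have i2 : 'i * 'i = -1 :> R[i] by rewrite -expr2 sqr_i.
  have -> : (h ^+ 2 / 4)%:C = - (('i * (h / 2)%:C) * ('i * (h / 2)%:C)) :> R[i].
    by rewrite mulrACA i2 mulN1r opprK -real_complexM; congr (_%:C); field.
  rewrite mulNr opprK mulr_sumr.
  have -> : \sum_m expi (th m) * (((B h) l m - 'i * (h / 2)%:C * X l m) * (B h) m k
     + ('i * 2^-1%:C * X l m * (h ^+ 1)%:C) * ((B h) m k - 'i * (h / 2)%:C * X m k)) =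
     \sum_m (B h) l m * expi (th m) * (B h) m k -
     \sum_m 'i * (h / 2)%:C * ('i * (h / 2)%:C) * (X l m * expi (th m) * X m k).
    rewrite -sumrB; apply: eq_bigr => m _; rewrite expr1 real_complexM; ring.
  ring.
apply: powOD; first by apply: powO_cst; exact: w3.
apply: powO_sum => m; apply: powO_cst; apply: powOD.
  exact: (@powOM _ _ 2 1 _ _ (B2 _ _) (B1 _ _)).
exact: (@powOM _ _ 1 2 _ _ (powO_X _ _ _) (B2 _ _)).
Qed.

Let wVw2 l k : powO 2 (fun h => (wVw h) l k - (V l k
  + 'i * (h / 2)%:C * X l k * (expi (th k) + expi (th l)))).
Proof.
apply: (@powO_eq _ _ _ (fun h => ((wVw h) l k - (V l k
  + ('i * (h / 2)%:C * X l k - (h ^+ 2 / 8)%:C * Y l k) * (expi (th k) + expi (th l))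
  - (h ^+ 2 / 4)%:C * \sum_m X l m * expi (th m) * X m k)) -
  ((8^-1)%:C * Y l k * (expi (th k) + expi (th l))
    + (4^-1)%:C * \sum_m X l m * expi (th m) * X m k) * (h ^+ 2)%:C)); last first.
  by apply: powOB; [exact: powO_weaken (wVw3 l k)|exact: powO_X].
by move=> h _; rewrite !real_complexM; ring.
Qed.

Let wVw1 l k : powO 1 (fun h => (wVw h) l k - V l k).
Proof.
apply: (@powO_eq _ _ _ (fun h => ((wVw h) l k - (V l k
  + 'i * (h / 2)%:C * X l k * (expi (th k) + expi (th l)))) +
  ('i * (2^-1)%:C * X l k * (expi (th k) + expi (th l))) * (h ^+ 1)%:C)); last first.
  by apply: powOD; [exact: powO_weaken (wVw2 l k)|exact: powO_X].
by move=> h _; rewrite expr1 !real_complexM; ring.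
Qed.

(** [U h] diagonalizes [wVw h] and [V] is diagonal, so an entry of [(wVw h - V) U] is a difference
    of eigenvalues times an entry of [U]. *)
Let wVwU h l j : D h -> \sum_m ((wVw h) l m - V l m) * U h m j =
  (expi (d h j) - expi (th l)) * U h l j.
Proof.
move=> Dh; transitivity (((wVw h - V) *m U h) l j).
  by rewrite [RHS]mxE; apply: eq_bigr => m _; rewrite [(_ - V) _ _]mxE [(- V) _ _]mxE.
rewrite -UdE // mulmxBl.
have -> : udiag (U h) (fun j => expi (d h j)) *m U h =
    U h *m diag_mx (\row_j expi (d h j)).
  by rewrite /udiag -[LHS]mulmxA unitarymxK ?mulmx1 //; exact: Uu.
have subE (P Q : 'M[R[i]]_n) : (P - Q) l j = P l j - Q l j.
  by rewrite mxE [X in _ + X]mxE.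
by rewrite VE subE mul_mx_diag mul_diag_mx !mxE; ring.
Qed.

Let dist_le_pi h j l : D h -> `|d h j - th l| <= pi.
Proof.
move=> Dh; apply: le_trans (ler_normB _ _) _.
have := dpi j Dh; have := thpi l; lra.
Qed.

(** On angles at most [pi] apart, chord and arc are comparable, so [wVwU] transfers the closeness of
    [wVw h] to [V]. This holds for any choice of eigenbasis. *)
Let g1 l j : powO 1 (fun h => (d h j - th l)%:C * U h l j).
Proof.
apply: (@powO_le _ _ _ _ (fun h => \sum_m ((wVw h) l m - V l m) * U h m j) 3) => //.
  move=> h Dh; rewrite wVwU // !cmodM cmod_real mulrA ler_wpM2r ?cmod_ge0 //.
  by apply: dist_le_cmod_expi_sub; exact: dist_le_pi.
apply: powO_sum => m; rewrite -[1%N]addn0; apply: powOM; first exact: wVw1.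
by apply: (@powO_0 _ _ _ 1) => h Dh; exact/unitarymx_cmod_le1/Uu.
Qed.

(** The [(l, k)] entry of [U diag(d) U^* - diag(th)]: unitarity allows [th k] under the sum, where
    [g1] applies. *)
Let y l k (h : R) := \sum_j U h l j * (d h j - th k)%:C * cj (U h k j).

Let U_row h l k : D h -> \sum_j U h l j * cj (U h k j) = (l == k)%:R.
Proof.
move=> /Uu /unitarymxVK /matrixP /(_ l k); rewrite !mxE => <-.
by apply: eq_bigr => j _; rewrite !mxE.
Qed.

Let U_col h i j : D h -> \sum_l cj (U h l i) * U h l j = (i == j)%:R.
Proof.
move=> /Uu /unitarymxK /matrixP /(_ i j); rewrite !mxE => <-.
by apply: eq_bigr => l _; rewrite !mxE.
Qed.

Let U_bounded l j : powO 0 (fun h => U h l j).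
Proof. by apply: (@powO_0 _ _ _ 1) => h Dh; exact/unitarymx_cmod_le1/Uu. Qed.

Let y1 l k : powO 1 (y l k).
Proof.
apply: powO_sum => j.
apply: (@powO_eq _ _ _ (fun h => U h l j * cj ((d h j - th k)%:C * U h k j))).
  by move=> h _; rewrite conjM conj_real mulrA.
exact: (@powOM _ _ 0 1 _ _ (U_bounded _ _) (powO_conj (g1 _ _))).
Qed.

Let rot_wVw l k h : D h -> expi (- th k) * (wVw h) l k =
  \sum_j U h l j * expi (d h j - th k) * cj (U h k j).
Proof.
move=> Dh; rewrite -UdE // udiagE mulr_sumr; apply: eq_bigr => j _.
by rewrite expiD; ring.
Qed.

Let V_offdiag l k : l != k -> V l k = 0.
Proof. by rewrite VE !mxE => /negbTE ->. Qed.

(** Replacing [expi a - 1] by its chord between [0] and [th l - th k] turns the entry of [wVw h]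
    into a multiple of [y l k h]. The error [r] vanishes at both ends, so [g1] applies twice and
    gives order 2. *)
Let y_first_order l k : th l != th k ->
  powO 2 (fun h => (expi (th l - th k) - 1) * y l k h -
    (th l - th k)%:C * (1 + expi (th l - th k)) * ('i * (h / 2)%:C * X l k)).
Proof.
move=> tlk; pose b := th l - th k; have b0 : b != 0 by rewrite subr_eq0.
have lk : l != k by apply: contraNneq tlk => ->.
pose r h := \sum_j U h l j *
  (expi (d h j - th k) - 1 - ((d h j - th k) / b)%:C * (expi b - 1)) * cj (U h k j).
have rE h : D h -> b%:C * r h =
    b%:C * expi (- th k) * (wVw h) l k - (expi b - 1) * y l k h.
  move=> Dh; rewrite -mulrA rot_wVw //.
  have -> : \sum_j U h l j * expi (d h j - th k) * cj (U h k j) =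
      \sum_j U h l j * (expi (d h j - th k) - 1) * cj (U h k j).
    transitivity (\sum_j U h l j * expi (d h j - th k) * cj (U h k j) -
      \sum_j U h l j * cj (U h k j)); first by rewrite U_row // (negbTE lk) subr0.
    by rewrite -sumrB; apply: eq_bigr => j _; ring.
  rewrite /r /y !mulr_sumr.
  rewrite -sumrB; apply: eq_bigr => j _.
  have e : b%:C * ((d h j - th k) / b)%:C = (d h j - th k)%:C.
    by rewrite -real_complexM mulrC divfK.
  by rewrite -e; ring.
have r2 : powO 2 r.
  apply: powO_sum => j.
  apply: (@powO_le _ _ _ _ (fun h => ((d h j - th k)%:C * U h k j) *
      ((d h j - th l)%:C * U h l j)) (2 / `|b|)); last 2 first.
  - by rewrite divr_ge0.
  - exact: (@powOM _ _ 1 1 _ _ (g1 _ _) (g1 _ _)).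
  move=> h Dh; have := chord_quotient_remainder (d h j - th k) b0.
  have -> : d h j - th k - b = d h j - th l by rewrite /b; ring.
  rewrite !cmodM !cmod_real cmod_conj => H.
  have -> : 2 / `|b| * (`|d h j - th k| * cmod (U h k j) *
      (`|d h j - th l| * cmod (U h l j))) =
    cmod (U h l j) * cmod (U h k j) *
      (2 / `|b| * (`|d h j - th k| * `|d h j - th l|)) by ring.
  by rewrite mulrAC ler_wpM2l // mulr_ge0 ?cmod_ge0.
apply: (@powO_eq _ _ _ (fun h => b%:C * expi (- th k) * ((wVw h) l k - (V l k
  + 'i * (h / 2)%:C * X l k * (expi (th k) + expi (th l)))) - b%:C * r h)); last first.
  by apply: powOB; apply: powO_cst; [exact: wVw2|exact: r2].
move=> h Dh; rewrite rE // V_offdiag // -/b.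
have -> : expi b = expi (th l) * expi (- th k) by rewrite -expiD.
have := expi_mulN (th k); move: (expi (th k)) (expi (- th k)) => e f ef.
rewrite -ef; ring.
Qed.

Let weight (l k : 'I_n) := cmod (X k l) ^+ 2.

Let sqr_y l k : th l != th k -> powO 3 (fun h => (cmod (y l k h) ^+ 2)%:C -
  (((th l - th k) ^+ 2 * (2 + 2 * cos (th l - th k)) /
   (4 * (2 - 2 * cos (th l - th k))) * weight l k * h ^+ 2)%:C)).
Proof.
move=> tlk; set b := th l - th k; have b0 : b != 0 by rewrite subr_eq0.
have c0 : 0 < 2 - 2 * cos b.
  have := @sqr_le_chord R b; have bpi : `|b| <= pi.
    apply: le_trans (ler_normB _ _) _; have := thpi l; have := thpi k; lra.
  move=> /(_ bpi); have : 0 < b ^+ 2 by rewrite exprn_even_gt0.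
  lra.
pose E := expi b - 1.
pose z (h : R) := b%:C * (1 + expi b) * ('i * (h / 2)%:C * X l k).
have nE : E * cj E = (2 - 2 * cos b)%:C.
  by rewrite mul_conj /E -expi0 sqr_cmod_expi_sub subr0.
have nF : (1 + expi b) * cj (1 + expi b) = (2 + 2 * cos b)%:C.
  rewrite mul_conj sqr_cmod /=; congr (_%:C).
  by have := cos2Dsin2 b; rewrite add0r sqrrD; lra.
have y2 := y_first_order tlk.
have z1 : powO 1 z.
  apply: (@powO_eq _ _ _ (fun h => (b%:C * (1 + expi b) * ('i * (2^-1)%:C * X l k)) *
    (h ^+ 1)%:C)); last exact: powO_X.
  by move=> h _; rewrite /z expr1 real_complexM; ring.
(* This is [|u|^2 - |v|^2 = (u - v) conj u + v conj (u - v)] for [u = E * y l k h] and its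
   first-order value [v = z h]. *)
apply: (@powO_eq _ _ _ (fun h => ((2 - 2 * cos b)^-1)%:C *
    ((E * y l k h - z h) * cj (E * y l k h) + z h * cj (E * y l k h - z h)))).
  move=> h Dh.
  have -> : (E * y l k h - z h) * cj (E * y l k h) + z h * cj (E * y l k h - z h) =
      E * cj E * (y l k h * cj (y l k h)) - z h * cj (z h).
    by rewrite rmorphB /= !conjM; ring.
  have -> : z h * cj (z h) = b%:C * b%:C * ((1 + expi b) * cj (1 + expi b)) *
    ('i * cj 'i) * ((h / 2)%:C * (h / 2)%:C) * (X l k * cj (X l k)).
    by rewrite /z !conjM !conj_real; ring.
  rewrite nF nE [X in _ * X * (_ * _) * _]mul_conj cmod_i !mul_conj.
  rewrite -[X l k]X_adj cmod_conj -!real_complexM -rmorphB -real_complexM -rmorphB.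
  by congr (_%:C); rewrite /weight; field; lra.
apply: powO_cst; apply: powOD.
  apply: (@powOM _ _ 2 1) => //; apply: powO_conj; apply: powO_cst; exact: y1.
by apply: (@powOM _ _ 1 2) => //; apply: powO_conj.
Qed.

Let diff_le4 (a b : R) : `|a| < pi / 2 -> `|b| < pi / 2 -> `|a - b| <= 4.
Proof.
move=> ha hb; apply: le_trans (ler_normB _ _) _.
have := pihalf_lt2 R; lra.
Qed.

Let sum_y h k j : D h -> \sum_l y l k h * cj (U h l j) =
  (d h j - th k)%:C * cj (U h k j).
Proof.
move=> Dh; rewrite /y; under eq_bigr do rewrite mulr_suml.
rewrite exchange_big /=.
transitivity (\sum_i (\sum_l cj (U h l j) * U h l i) *
   ((d h i - th k)%:C * cj (U h k i))).
  apply: eq_bigr => i _; rewrite mulr_suml; apply: eq_bigr => l _; ring.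
rewrite (bigD1 j) //= U_col // eqxx mul1r big1 ?addr0 // => i ij.
by rewrite U_col // eq_sym (negbTE ij) mul0r.
Qed.

(** Write [a - sin a = a ^+ 2 * chi a]. If [chi] were constant, the two sums would agree by
    Parseval. The error has three first-order factors: an entry [y], a product as in [g1], and the
    variation of [chi] times an entry of [U]. *)
Let psi_sum k : powO 3 (fun h =>
  \sum_j (cmod (U h k j) ^+ 2 * ((d h j - th k) - sin (d h j - th k)))%:C -
  \sum_l (chi (th l - th k))%:C * (cmod (y l k h) ^+ 2)%:C).
Proof.
apply: (@powO_eq _ _ _ (fun h => \sum_l y l k h * \sum_j
  ((d h j - th k)%:C * U h k j) *
  (cj (U h l j) * (chi (d h j - th k) - chi (th l - th k))%:C))).
  move=> h Dh.
  have -> : \sum_j (cmod (U h k j) ^+ 2 * (d h j - th k - sin (d h j - th k)))%:C =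
    \sum_j (d h j - th k)%:C * U h k j * (chi (d h j - th k))%:C *
      \sum_l y l k h * cj (U h l j).
    apply: eq_bigr => j _; rewrite sum_y //; set a := d h j - th k.
    have -> : a - sin a = a * (a * chi a) by rewrite mulrA -expr2 sqr_mul_chi.
    by rewrite real_complexM -mul_conj !real_complexM; ring.
  under [X in _ = X - _]eq_bigr do rewrite mulr_sumr.
  rewrite exchange_big -sumrB; apply: eq_bigr => l _.
  rewrite -mul_conj.
  have -> : cj (y l k h) = \sum_j cj (U h l j) * (d h j - th k)%:C * U h k j.
    by rewrite /y conj_sum; apply: eq_bigr => j _; rewrite !conjM conj_real conjCK.
  rewrite !mulr_sumr -sumrB; apply: eq_bigr => j _; rewrite rmorphB; ring.
apply: powO_sum => l; apply: (@powOM _ _ 1 2); first exact: y1.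
apply: powO_sum => j; apply: (@powOM _ _ 1 1); first exact: g1.
have [K K0 HK] := chi_lipschitz (diff_le4 (thpi l) (thpi k)).
apply: (@powO_le _ _ _ _ (fun h => (d h j - th l)%:C * U h l j) K) => // h Dh.
rewrite !cmodM !cmod_real cmod_conj mulrC mulrA ler_wpM2r ?cmod_ge0 //.
apply: le_trans (HK _ (diff_le4 (dpi j Dh) (thpi k))) _.
by have -> : d h j - th k - (th l - th k) = d h j - th l by ring.
Qed.

(** The averaged sine is the imaginary part of a rotated diagonal entry of [wVw h], which is known
    explicitly; [Y k k] is real and drops out. *)
Let sin_sum k : powO 3 (fun h =>
  \sum_j (cmod (U h k j) ^+ 2 * sin (d h j - th k))%:C -
  (h * Re (X k k) - h ^+ 2 / 4 * \sum_m weight m k * sin (th m - th k))%:C).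
Proof.
have Yk : Y k k = (\sum_m weight m k)%:C.
  rewrite mxE rmorph_sum; apply: eq_bigr => m _.
  by rewrite -[X m k]X_adj mul_conj.
apply: (@powO_eq _ _ _ (fun h => (Im (expi (- th k) * ((wVw h) k k - (V k k
  + ('i * (h / 2)%:C * X k k - (h ^+ 2 / 8)%:C * Y k k) * (expi (th k) + expi (th k))
  - (h ^+ 2 / 4)%:C * \sum_m X k m * expi (th m) * X m k))))%:C)); last first.
  by apply: powO_Im; apply: powO_cst; exact: wVw3.
move=> h Dh; rewrite -rmorph_sum -rmorphB; congr (_%:C).
have Vk : V k k = expi (th k) by rewrite VE !mxE eqxx.
have -> : expi (- th k) * ((wVw h) k k - (V k k
  + ('i * (h / 2)%:C * X k k - (h ^+ 2 / 8)%:C * Y k k) * (expi (th k) + expi (th k))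
  - (h ^+ 2 / 4)%:C * \sum_m X k m * expi (th m) * X m k)) =
  expi (- th k) * (wVw h) k k - (1 + 'i * (h%:C * X k k) - (h ^+ 2 / 4)%:C * Y k k
  - (h ^+ 2 / 4)%:C * \sum_m (weight m k)%:C * expi (th m - th k)).
  have -> : \sum_m (weight m k)%:C * expi (th m - th k) =
    expi (- th k) * \sum_m X k m * expi (th m) * X m k.
    rewrite mulr_sumr; apply: eq_bigr => m _.
    by rewrite /weight -mul_conj X_adj expiD; ring.
  rewrite Vk; have := expi_mulN (th k); move: (expi (th k)) (expi (- th k)) => e f ef.
  have h2 : (h / 2)%:C + (h / 2)%:C = h%:C :> R[i].
    by rewrite -rmorphD; congr (_%:C); field.
  have h8 : (h ^+ 2 / 8)%:C + (h ^+ 2 / 8)%:C = (h ^+ 2 / 4)%:C :> R[i].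
    by rewrite -rmorphD; congr (_%:C); field.
  set T := \sum_m X k m * expi (th m) * X m k; rewrite -h2 -h8.
  set a := (h / 2)%:C; set b := (h ^+ 2 / 8)%:C.
  transitivity (f * (wVw h) k k - (e * f * (1 + 'i * ((a + a) * X k k)
    - (b + b) * Y k k) - (b + b) * (f * T))); last by rewrite ef mul1r.
  ring.
rewrite rot_wVw // Yk -real_complexM.
have -> : \sum_j U h k j * expi (d h j - th k) * cj (U h k j) =
    \sum_j (cmod (U h k j) ^+ 2)%:C * expi (d h j - th k).
  by apply: eq_bigr => j _; rewrite -mul_conj; ring.
have ImB (u v : R[i]) : Im (u - v) = Im u - Im v by case: u v => ? ? [].
have ImD (u v : R[i]) : Im (u + v) = Im u + Im v by case: u v => ? ? [].
have ImR (a : R) (u : R[i]) : Im (a%:C * u) = a * Im u.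
  by case: u => u1 u2 /=; ring.
have Imi (u : R[i]) : Im ('i * u) = Re u by case: u => u1 u2 /=; ring.
have ReR (a : R) (u : R[i]) : Re (a%:C * u) = a * Re u.
  by case: u => u1 u2 /=; ring.
have Im0 (a : R) : Im a%:C = 0 by [].
rewrite !ImB ImD ImR Imi ReR !Im_sum Im0 (Im0 1) add0r subr0.
by congr (_ - (_ - _ * _)); apply: eq_bigr => m _; rewrite ImR.
Qed.

Lemma diagonal_expansion k : exists K, forall h, D h ->
  `|\sum_j cmod (U h k j) ^+ 2 * d h j - (th k + h * Re (X k k) + h ^+ 2 *
     \sum_l cmod (X k l) ^+ 2 * mu (th l - th k) * (th k - th l))| <= K * `|h| ^+ 3.
Proof.
have sqrO : powO 3 (fun h => \sum_l (chi (th l - th k))%:C *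
   ((cmod (y l k h) ^+ 2)%:C -
  (((th l - th k) ^+ 2 * (2 + 2 * cos (th l - th k)) /
   (4 * (2 - 2 * cos (th l - th k))) * weight l k * h ^+ 2)%:C))).
  (* For equal eigenvalues [sqr_y] does not apply, but the factor [chi 0 = 0] removes the term. *)
  apply: powO_sum => l; have [e|tlk] := eqVneq (th l) (th k).
    apply: (@powO_eq _ _ _ (fun h => 0 * (h ^+ 3)%:C)); last exact: powO_X.
    by move=> h _; rewrite e subrr /chi sin0 subrr !mul0r.
  by apply: powO_cst; exact: sqr_y.
have [K HK] := powOD (powOD (psi_sum k) (sin_sum k)) sqrO.
exists K => h Dh; apply: le_trans (HK h Dh).
rewrite -[X in X <= _]cmod_real le_eqVlt; apply/orP; left; apply/eqP; congr cmod.
rewrite -!rmorph_sum.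
under [X in _ = _ + X]eq_bigr do rewrite -rmorphB -real_complexM.
under [X in _ = (_ - X) + _ + _]eq_bigr do rewrite -real_complexM.
rewrite -!rmorph_sum -!rmorphB -!rmorphD; congr (_%:C).
have S1 := sum_sqr_cmod_unitarymx k (Uu Dh).
have -> : \sum_j cmod (U h k j) ^+ 2 * d h j - (th k + h * Re (X k k) + h ^+ 2 *
     \sum_l cmod (X k l) ^+ 2 * mu (th l - th k) * (th k - th l)) =
  \sum_j cmod (U h k j) ^+ 2 * (d h j - th k) - h * Re (X k k) - h ^+ 2 *
     \sum_l cmod (X k l) ^+ 2 * mu (th l - th k) * (th k - th l).
  under [X in _ = X - _ - _]eq_bigr do rewrite mulrBr.
  by rewrite sumrB -mulr_suml S1; ring.
have -> : \sum_j cmod (U h k j) ^+ 2 * (d h j - th k) =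
  \sum_j cmod (U h k j) ^+ 2 * (d h j - th k - sin (d h j - th k)) +
  \sum_j cmod (U h k j) ^+ 2 * sin (d h j - th k).
  by rewrite -big_split /=; apply: eq_bigr => j _; ring.
have -> : h ^+ 2 * \sum_l cmod (X k l) ^+ 2 * mu (th l - th k) * (th k - th l) =
  \sum_l chi (th l - th k) * ((th l - th k) ^+ 2 * (2 + 2 * cos (th l - th k)) /
   (4 * (2 - 2 * cos (th l - th k))) * weight l k * h ^+ 2)
  - h ^+ 2 / 4 * \sum_m weight m k * sin (th m - th k).
  rewrite !mulr_sumr -sumrB; apply: eq_bigr => l _; rewrite -/(weight l k).
  move: (weight l k) => W.
  have [->|tlk] := eqVneq (th l) (th k).
    by rewrite subrr /chi sin0; ring.
  set b := th l - th k; have b0 : b != 0 by rewrite subr_eq0.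
  have -> : th k - th l = - b by rewrite opprB.
  have c0 : 0 < 2 - 2 * cos b.
    have bpi : `|b| <= pi.
      apply: le_trans (ler_normB _ _) _; have := thpi l; have := thpi k; lra.
    have := sqr_le_chord bpi; have : 0 < b ^+ 2 by rewrite exprn_even_gt0.
    lra.
  by rewrite /mu /chi; field; rewrite b0 /=; lra.
under [X in _ = _ + X]eq_bigr do rewrite mulrBr.
rewrite sumrB; ring.
Qed.

Lemma continuity_estimate l k : exists K, forall h, D h ->
  cmod (udiag (U h) (fun j => 'i * (d h j)%:C) l k - idiag th l k) <= K * `|h|.
Proof.
have [K HK] := y1 l k; exists K => h Dh.
have -> : udiag (U h) (fun j => 'i * (d h j)%:C) l k - idiag th l k = 'i * y l k h.
  have -> : idiag th l k = 'i * (th k)%:C * \sum_j U h l j * cj (U h k j).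
    by rewrite U_row // idiagE; case: eqP => [->|]; rewrite ?mulr1 ?mulr0.
  rewrite udiagE /y !mulr_sumr -sumrB; apply: eq_bigr => j _; rewrite rmorphB; ring.
by rewrite cmodM cmod_i mul1r -[`|h|]expr1 HK.
Qed.

End DiagonalExpansion.

(** * Convexity *)

Section Convexity.
Variables (R : realType) (n : nat) (N : 'M[R[i]]_n -> R).
Hypotheses (hN : is_norm_on_su N) (hAd : Ad_invariant N).

Lemma spread_sum0 (th : 'I_n -> R) (m : 'I_n -> 'I_n -> R) :
  (forall k l, m k l = m l k) -> \sum_k \sum_l m k l * (th k - th l) = 0.
Proof.
move=> mC; set T := \sum_k _.
suff : T = - T by move: T => T; lra.
rewrite {1}/T exchange_big -sumrN; apply: eq_bigr => k _.
by rewrite -sumrN; apply: eq_bigr => l _; rewrite mC; ring.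
Qed.

Lemma su_norm_dist v w : su v -> su w -> `|N v - N w| <= N (v - w).
Proof.
move=> sv sw.
have sN (u : 'M[R[i]]_n) : su u -> su (- u).
  by move=> [u1 u2]; split; [rewrite linearN /= map_mxN u1|rewrite linearN /= u2 oppr0].
have sB (u u' : 'M[R[i]]_n) : su u -> su u' -> su (u - u').
  by move=> su1 su2; apply: suD => //; exact: sN.
have NN u : su u -> N (- u) = N u.
  move=> su1; rewrite -[RHS]mul1r -(normrN1 R) -(su_normZ hN) //; congr N.
  by rewrite -scaleN1r; congr (_ *: _); rewrite rmorphN.
have H u u' : su u -> su u' -> N u - N u' <= N (u - u').
  move=> su1 su2; rewrite lerBlDr -{1}(subrK u' u).
  by apply: (su_normD hN) => //; exact: sB.
rewrite ler_norml H // andbT lerNl opprB.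
by rewrite -(NN _ (sB _ _ sv sw)) opprB H.
Qed.

(** For [M = exp (- h x / 2)], conjugating [exp (h x) exp (xt c)] by [M] moves half of [exp (h x)]
    to the right; [Q] is the eigenbasis of [xt c]. *)
Lemma symmetrize_product (Q M G : 'M[R[i]]_n) : M \is unitarymx ->
  Q^t* *m M *m (M^t* *m M^t* *m (Q *m G *m Q^t*)) *m (Q^t* *m M)^t* =
  Q^t* *m M^t* *m Q *m G *m (Q^t* *m M^t* *m Q).
Proof.
move=> Mu; have -> : (Q^t* *m M)^t* = M^t* *m Q by rewrite trmx_mul map_mxM trmxCK.
have := unitarymxVK Mu; move: (M^t*) (Q^t*) => M' Q' MM'.
by rewrite !mulmxA -[Q' *m M *m M']mulmxA MM' mulmx1.
Qed.

Lemma expmx_imaginary_multiple (S : 'M[R[i]]_n) (xs : 'I_n -> R) (t : R) : S \is unitarymx ->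
  expmx (t%:C *: udiag S (fun j => 'i * (xs j)%:C)) =
  udiag S (fun j => expi (t * xs j)).
Proof.
move=> Su.
have -> : t%:C *: udiag S (fun j => 'i * (xs j)%:C) =
    udiag S (fun j => 'i * (t * xs j)%:C).
  by rewrite udiagZ; apply: eq_udiag => j; rewrite real_complexM; ring.
exact: expmx_udiag.
Qed.

Variables (x y : 'M[R[i]]_n) (t1 t2 : R) (xt : R -> 'M[R[i]]_n).
Hypotheses (hx : su x)
  (hxt_su : forall t : R, t1 <= t <= t2 -> su (xt t))
  (hxt_exp : forall t : R, t1 <= t <= t2 ->
     expmx (t%:C *: x) *m expmx y = expmx (xt t))
  (hxt_lt : forall t : R, t1 <= t <= t2 -> spectral_norm (xt t) < pi / 2).

(* Everything is seen in an eigenbasis of [xt c], after the unitary conjugation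
   by [exp (- h x / 2)], which turns [exp (h x) exp (xt c)] into the symmetric
   product [w h *m V *m w h]. *)
Lemma local_model (c : R) : t1 <= c <= t2 ->
  let D h := t1 <= c + h <= t2 /\ `|h| <= 1 in
  exists th S xs U d,
  [/\ \sum_k th k = 0, forall k, `|th k| < pi / 2 & N (xt c) = diagN N th] /\
  [/\ S \is unitarymx,
    forall h, D h -> U h \is unitarymx,
    forall h j, D h -> `|d h j| < pi / 2,
    forall h, D h -> su (udiag (U h) (fun j => 'i * (d h j)%:C)) /\
      N (udiag (U h) (fun j => 'i * (d h j)%:C)) = N (xt (c + h)) &
    forall h, D h -> udiag (U h) (fun j => expi (d h j)) =
      udiag S (fun j => expi (h / 2 * xs j)) *m diag_mx (\row_j expi (th j)) *m
      udiag S (fun j => expi (h / 2 * xs j))].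
Proof.
move=> cI D.
have [[xN _] [cN _]] := (hx, hxt_su cI).
have [Sx [xs [Sxu xE]]] := skew_hermitian_udiag xN.
have [Q [th [Qu cE]]] := skew_hermitian_udiag cN.
have Qu' : Q^t* \is unitarymx by rewrite trmxC_unitary.
have th0 : \sum_k th k = 0.
  by apply: (su_udiag_sum0 Qu); rewrite -cE; exact: hxt_su.
have [p Hp] : exists p : R -> 'M[R[i]]_n * ('I_n -> R), forall h, D h ->
    (p h).1 \is unitarymx /\
    xt (c + h) = udiag (p h).1 (fun j => 'i * ((p h).2 j)%:C).
  (* The choice of eigenbases is made for all [h], with a dummy pair outside [D]. *)
  have /choice[p Hp] : forall h, exists q : 'M[R[i]]_n * ('I_n -> R), D h ->
    q.1 \is unitarymx /\ xt (c + h) = udiag q.1 (fun j => 'i * (q.2 j)%:C).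
    move=> h; have [[hI _]|nD] := pselect (D h); last by exists (0, fun=> 0).
    have [hN' _] := hxt_su hI; have [Z [d [Zu ZE]]] := skew_hermitian_udiag hN'.
    by exists (Z, d).
  by exists p.
have [Wm [Wmu WmE]] : exists Wm : R -> 'M[R[i]]_n,
    (forall h, Wm h \is unitarymx) /\
    (forall h, (Wm h)^t* = udiag Sx (fun j => expi (h / 2 * xs j))).
  exists (fun h => udiag Sx (fun j => expi (- (h / 2 * xs j)))); split => h.
    apply/unitarymxP; rewrite udiag_adj udiagM // -[RHS](udiag1 Sxu).
    by apply: eq_udiag => j; rewrite conj_expi expi_mulN.
  by rewrite udiag_adj; apply: eq_udiag => j; rewrite conj_expi opprK.
pose U h := Q^t* *m Wm h *m (p h).1.
have Uu h : D h -> U h \is unitarymx.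
  by move=> /Hp[pu _]; exact: mul_unitarymx (mul_unitarymx Qu' (Wmu h)) pu.
exists th, (Q^t* *m Sx), xs, U, (fun h => (p h).2).
split; split.
- exact: th0.
- by move=> k; rewrite (le_lt_trans (udiag_le_spectral_norm th k Qu)) // -cE hxt_lt.
- by rewrite cE (norm_udiag hAd Qu th0).
- exact: mul_unitarymx Qu' Sxu.
- exact: Uu.
- move=> h j Dh; have [pu pE] := Hp _ Dh; have [hI _] := Dh.
  by rewrite (le_lt_trans (udiag_le_spectral_norm _ _ pu)) // -pE hxt_lt.
- move=> h Dh; have [pu pE] := Hp _ Dh; have [hI _] := Dh.
  have sp := hxt_su hI; rewrite -udiag_mul -pE.
  have QW := mul_unitarymx Qu' (Wmu h).
  by split; [exact: su_conj QW sp|exact: norm_unitary_conj hAd _ _ QW sp].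
move=> h Dh; have [pu pE] := Hp _ Dh; have [hI _] := Dh.
(* [exp ((c + h) x)] factors as [exp (h x) exp (c x)] in an eigenbasis of [x], and [expmx y] is
   absorbed into [expmx (xt c)]. *)
have E : expmx (xt (c + h)) = (Wm h)^t* *m (Wm h)^t* *m expmx (xt c).
  rewrite -(hxt_exp hI) -(hxt_exp cI) mulmxA; congr (_ *m _).
  rewrite xE (expmx_imaginary_multiple _ _ Sxu) (expmx_imaginary_multiple _ _ Sxu) WmE.
  rewrite (udiagM _ _ Sxu) (udiagM _ _ Sxu).
  by apply: eq_udiag => j; rewrite -!expiD; congr expi; field.
rewrite -udiag_mul -(expmx_udiag (p h).2 pu) -pE E cE (expmx_udiag th Qu).
have -> : udiag (Q^t* *m Sx) (fun j => expi (h / 2 * xs j)) = Q^t* *m (Wm h)^t* *m Q.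
  by rewrite -udiag_mul -WmE trmxCK.
exact: (@symmetrize_product Q (Wm h) _ (Wmu h)).
Qed.

(** Supplies the continuity, endpoints included, behind the maximum argument of
    [le_chord_of_second_difference]. *)
Lemma norm_log_lipschitz (c : R) : t1 <= c <= t2 -> exists K, forall t,
  t1 <= t <= t2 -> `|t - c| <= 1 -> `|N (xt t) - N (xt c)| <= K * `|t - c|.
Proof.
move=> cI; have [th [S [xs [U [d [[th0 thpi ->] [Su Uu dpi sN UdE]]]]]]] := local_model cI.
have D1 h : t1 <= c + h <= t2 /\ `|h| <= 1 -> `|h| <= 1 by case.
have est l k := continuity_estimate D1 thpi erefl
  (fun k l => one_parameter_group_expansion _ xs k l Su) Uu dpi UdE l k.
have /choice[K1 HK1] : forall p : 'I_n * 'I_n, exists K, forall h,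
    t1 <= c + h <= t2 /\ `|h| <= 1 ->
    cmod (udiag (U h) (fun j => 'i * (d h j)%:C) p.1 p.2 - idiag th p.1 p.2) <= K * `|h|.
  by move=> p; exact: est.
have [K2 K20 HK2] := norm_bounded hN hAd.
exists (K2 * \sum_p `|K1 p|) => t tI tc.
have Dh : t1 <= c + (t - c) <= t2 /\ `|t - c| <= 1 by rewrite subrKC.
have [sA NA] := sN _ Dh; rewrite subrKC in NA; rewrite -NA.
have sth := su_idiag th0.
have sth' : su (- idiag th).
  by case: sth => u1 u2; split; [rewrite linearN /= map_mxN u1|rewrite linearN /= u2 oppr0].
apply: le_trans (su_norm_dist sA sth) _; rewrite -mulrA; apply: HK2.
  exact: suD.
move=> k l; rewrite mxE [X in _ + X]mxE.
apply: le_trans (HK1 (k, l) _ Dh) _; rewrite ler_wpM2r //.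
rewrite (le_trans (ler_norm _)) // (bigD1 (k, l)) //= lerDl.
by apply: sumr_ge0.
Qed.

Lemma norm_log_second_difference (c : R) : t1 <= c <= t2 -> exists K, forall h,
  0 < h <= 1 -> t1 <= c - h -> c + h <= t2 ->
  2 * N (xt c) - K * h ^+ 3 <= N (xt (c + h)) + N (xt (c - h)).
Proof.
move=> cI; have [th [S [xs [U [d [[th0 thpi ->] [Su Uu dpi sN UdE]]]]]]] := local_model cI.
have D1 h : t1 <= c + h <= t2 /\ `|h| <= 1 -> `|h| <= 1 by case.
have X_adj := conj_udiag_real S xs.
have exp k := diagonal_expansion D1 thpi erefl X_adj
  (fun k l => one_parameter_group_expansion _ xs k l Su) Uu dpi UdE k.
move: X_adj exp; set X := udiag S (fun j => (xs j)%:C) => X_adj exp.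
pose m k l := cmod (X k l) ^+ 2 * mu (th l - th k).
have mC k l : m k l = m l k.
  by rewrite /m -X_adj cmod_conj -(opprB (th k)) muN.
have m0 k l : 0 <= m k l.
  rewrite mulr_ge0 ?sqr_ge0 // mu_ge0 //.
  by apply: le_trans (ler_normB _ _) _; have := thpi l; have := thpi k; lra.
pose a k := \sum_l m k l * (th k - th l).
have a0 : \sum_k a k = 0 by exact: spread_sum0.
have /choice[K1 HK1] := exp.
pose g h k := \sum_j cmod (U h k j) ^+ 2 * d h j.
have gE h : t1 <= c + h <= t2 /\ `|h| <= 1 ->
    \sum_k g h k = 0 /\ diagN N (g h) <= N (xt (c + h)).
  move=> Dh; have [sA NA] := sN _ Dh; rewrite -NA.
  have gA k : g h k = Im (udiag (U h) (fun j => 'i * (d h j)%:C) k k).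
    rewrite udiagE Im_sum; apply: eq_bigr => j _.
    have -> : U h k j * ('i * (d h j)%:C) * Num.conj (U h k j) =
      'i * (cmod (U h k j) ^+ 2 * d h j)%:C.
      by rewrite real_complexM -mul_conj; ring.
    by rewrite /=; ring.
  have [H1 H2] := diagN_diagonal_le hN hAd sA.
  split; first by rewrite -[RHS]H1; apply: eq_bigr => k _; exact: gA.
  by rewrite (eq_diagN _ gA).
have [K2 K20 HK2] := diagN_bounded hN.
exists (2 * K2 * \sum_k `|K1 k|) => h /andP[h0 h1] ch1 ch2.
have Dp : t1 <= c + h <= t2 /\ `|h| <= 1.
  by rewrite ch2 gtr0_norm // h1; split => //; rewrite andbT; lra.
have Dm : t1 <= c - h <= t2 /\ `|- h| <= 1.
  by rewrite ch1 normrN gtr0_norm // h1; split => //=; lra.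
have [gp0 gpN] := gE _ Dp; have [gm0 gmN] := gE _ Dm.
pose tt k := th k + h ^+ 2 * a k.
have tt0 : \sum_k tt k = 0 by rewrite big_split /= -mulr_sumr th0 a0 mulr0 addr0.
(* The linear terms cancel in [r], leaving only the two cubic remainders. Its sum is 0, as
   [diagN_bounded] requires, because every vector involved has sum 0. *)
pose r k := g h k + g (- h) k - 2 * tt k.
have r0 : \sum_k r k = 0.
  by rewrite sumrB big_split /= gp0 gm0 -mulr_sumr tt0; ring.
have rB k : `|r k| <= 2 * (\sum_k `|K1 k|) * h ^+ 3.
  have := HK1 k h Dp; have := HK1 k (- h) Dm.
  rewrite normrN (gtr0_norm h0) -/(g h k) -/(g (- h) k) => Hm Hp.
  have -> : r k = (g h k - (th k + h * Re (X k k) + h ^+ 2 * a k)) +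
      (g (- h) k - (th k + (- h) * Re (X k k) + (- h) ^+ 2 * a k)).
    by rewrite /r /tt; ring.
  apply: le_trans (ler_normD _ _) (le_trans (lerD Hp Hm) _).
  rewrite -mulrDl; apply: ler_wpM2r; first by rewrite exprn_ge0 // ltW.
  have Kk : K1 k <= \sum_k `|K1 k|.
    by rewrite (le_trans (ler_norm _)) // (bigD1 k) //= lerDl sumr_ge0.
  lra.
have spread : diagN N th <= diagN N tt.
  by apply: (diagN_le_spread hN hAd th0 mC m0); exact: sqr_ge0.
have e1 : 2 * diagN N tt <= diagN N (fun k => g h k + g (- h) k) + diagN N r.
  rewrite -[X in X * _ <= _]normr_nat -(diagNZ hN) //.
  rewrite (@eq_diagN _ _ _ _ (fun k => (g h k + g (- h) k) + (- 1) * r k)); last first.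
    by move=> k; rewrite /r; ring.
  have Nr : diagN N (fun k => -1 * r k) = diagN N r.
    by rewrite (diagNZ hN) // normrN1 mul1r.
  rewrite -Nr; apply: (diagND hN).
    by rewrite big_split /= gp0 gm0 addr0.
  by rewrite -mulr_sumr r0 mulr0.
have e2 := diagND hN gp0 gm0.
have e3 := HK2 r _ r0 rB.
have -> : 2 * K2 * (\sum_k `|K1 k|) * h ^+ 3 = K2 * (2 * (\sum_k `|K1 k|) * h ^+ 3) by ring.
lra.
Qed.

End Convexity.

Unset Implicit Arguments.

Theorem theorem5p9 (R : realType) (n : nat) (x y : 'M[R[i]]_n) (t1 t2 : R)
    (xt : R -> 'M[R[i]]_n) (N : 'M[R[i]]_n -> R)
    (hx : su x) (hy : su y)
    (hxt_su : forall t : R, t1 <= t <= t2 -> su (xt t))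
    (hxt_exp : forall t : R, t1 <= t <= t2 ->
       expmx (t%:C *: x) *m expmx y = expmx (xt t))
    (hxt_lt : forall t : R, t1 <= t <= t2 -> spectral_norm (xt t) < pi / 2)
    (hN : is_norm_on_su N) (hAd : Ad_invariant N) :
  convex_function (E := R^o) `[t1, t2] (fun t : R => N (xt t)).
Proof.
apply: convex_of_second_difference => c.
  exact: (norm_log_lipschitz hN hAd hx hxt_su hxt_exp hxt_lt).
move=> /andP[/ltW t1c /ltW ct2].
apply: (norm_log_second_difference hN hAd hx hxt_su hxt_exp hxt_lt).
by rewrite t1c.
Qed.
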